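(* Let $\nu>0$, $d\in\{2,3\}$, and let $\omega,\hat\omega$ be kernels satisfying the kernel assumptions (K1)–(K4) stated in the context, with $\beta\in(-1,1)$ the exponent in (K4). Given $\delta>0$ and a $2\pi$-periodic, mean-zero vector field $\bm f$ on $\Omega=(-\pi,\pi)^d$, there exists a unique solution $(\bm u_\delta,p_\delta)$, $2\pi$-periodic and mean-zero, of the nonlocal Stokes system $$-\nu\mathcal L_\delta \bm u_\delta+\mathcal G_\delta p_\delta=\bm f,\qquad -\mathcal D_\delta\bm u_\delta=0\qquad\text{in }\Omega .$$ It is given in the form of its Fourier series, with coefficients computed, for every $\bm\xi\in\mathbb Z^d\setminus\{0\}$, through $$\begin{pmatrix}\widehat{\bm u}_\delta(\bm\xi)\\ \widehat p_\delta(\bm\xi)\end{pmatrix}=(A_\delta(\bm\xi))^{-1}\begin{pmatrix}\widehat{\bm f}(\bm\xi)\\0\end{pmatrix},$$ $$(A_\delta(\bm\xi))^{-1}=\begin{pmatrix}\frac{1}{\nu\lambda_\delta(\bm\xi)}\Big(I_d-\frac{\bm b_\delta(\bm\xi)\otimes\bm b_\delta(\bm\xi)}{|\bm b_\delta(\bm\xi)|^2}\Big)& i\frac{\bm b_\delta(\bm\xi)}{|\bm b_\delta(\bm\xi)|^2}\\ -i\frac{\bm b_\delta(\bm\xi)^T}{|\bm b_\delta(\bm\xi)|^2}&\frac{-\nu\lambda_\delta(\bm\xi)}{|\bm b_\delta(\bm\xi)|^2}\end{pmatrix}.$$ In addition, with a constant $C$ independent of $\delta$ and $\bm f$, $$\|\bm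 u_\delta\|_{[\mathcal S_\delta(\Omega)]^d}\le C\|\bm f\|_{[\mathcal S_\delta^*(\Omega)]^d},$$ $$\|p_\delta\|_{L^2(\Omega)}\le C\|\bm f\|_{[H^{-\beta}(\Omega)]^d}.$$
   Context: The parameter $\delta>0$ is the (small) nonlocal interaction length. Periodic functions (more generally periodic distributions) on $\Omega=(-\pi,\pi)^d$ with zero mean are identified with their Fourier coefficients: $g(\bm x)=(2\pi)^{-d}\sum_{\bm\xi\in\mathbb Z^d,\bm\xi\ne0}\widehat g(\bm\xi)e^{i\bm\xi\cdot\bm x}$, $\widehat g(\bm\xi)=\int_\Omega g(\bm x)e^{-i\bm\xi\cdot\bm x}d\bm x$. For mean-zero $g$ and $s\in\mathbb R$, $\|g\|_{H^s(\Omega)}^2=(2\pi)^{-d}\sum_{\bm\xi\neq0}|\bm\xi|^{2s}|\widehat g(\bm\xi)|^2$ and $\|\cdot\|_{L^2}=\|\cdot\|_{H^0}$. Each estimate is understood for $\bm f$ with finite right-hand side. Kernels. $\omega,\hat\omega:(0,\infty)\to[0,\infty)$ are measurable, vanish on $(1,\infty)$, and for $\delta>0$ one sets $\underline\omega_\delta(r)=\delta^{-(d+2)}\omega(r/\delta)$, $\hat\omega_\delta(r)=\delta^{-(d+1)}\hat\omega(r/\delta)$. Assumptions: (K1) $\frac12\int_{\mathbb R^d}\underline\omega_\delta(|\bm x|)|\bm x|^2d\bm x=d$; (K2) $\int_{\mathbb R^d}\hat\omega_\delta(|\bm x|)|\bm x|d\bm x=d$; (K3) $r^{d-1}\hat\omega(r)$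 is nonincreasing for $r\in(0,1)$; (K4) there are $\epsilon>0$, $c>0$ and $\beta\in(-1,1)$ with $\hat\omega(r)=c\,r^{-d-\beta}$ for $r\in(0,\epsilon)$. Operators. With $\vec\omega_\delta(\bm x)=\hat\omega_\delta(|\bm x|)\bm x/|\bm x|$, $\mathcal L_\delta\bm u(\bm x)=\int_{\mathbb R^d}\underline\omega_\delta(|\bm x-\bm y|)(\bm u(\bm y)-\bm u(\bm x))d\bm y$, $\mathcal G_\delta p(\bm x)=\int_{\mathbb R^d}\vec\omega_\delta(\bm y-\bm x)(p(\bm y)-p(\bm x))d\bm y$, $\mathcal D_\delta\bm u(\bm x)=\int_{\mathbb R^d}\vec\omega_\delta(\bm y-\bm x)\cdot(\bm u(\bm y)+\bm u(\bm x))d\bm y$ (principal value where needed). In Fourier variables they act by $\widehat{\mathcal L_\delta\bm u}=-\lambda_\delta\widehat{\bm u}$, $\widehat{\mathcal G_\delta p}=i\bm b_\delta\widehat p$, $\widehat{\mathcal D_\delta\bm u}=i\bm b_\delta^T\widehat{\bm u}$, where $\lambda_\delta(\bm\xi)=\int_{|\bm s|\le\delta}\underline\omega_\delta(|\bm s|)(1-\cos(\bm\xi\cdot\bm s))d\bm s$ and $\bm b_\delta(\bm\xi)=\int_{|\bm s|\le\delta}\hat\omega_\delta(|\bm s|)\frac{\bm s}{|\bm s|}\sin(\bm\xi\cdot\bm s)d\bm s$. Solutions are understood in this Fourier sense. $\mathcal S_\delta(\Omega)$ is the energy space of mean-zero periodic functions whose norm is associated with the Fourier symbol $\lambda_\delta(\bm\xi)^{1/2}$: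 $\|u\|_{\mathcal S_\delta}^2=(2\pi)^{-d}\sum_{\bm\xi\ne0}\lambda_\delta(\bm\xi)|\widehat u(\bm\xi)|^2$; $\mathcal S_\delta^*(\Omega)$ is its dual, with norm $\|f\|_{\mathcal S_\delta^*}^2=(2\pi)^{-d}\sum_{\bm\xi\neq0}\lambda_\delta(\bm\xi)^{-1}|\widehat f(\bm\xi)|^2$. The constant $C$ may depend on $d,\nu,\omega,\hat\omega$.
   Formalization: The pressure estimate is stated with C uniform over 0 < δ ≤ δ0 for each δ0 > 0 (C may depend on δ0), since uniformity over all δ > 0 fails: b_δ(ξ) → 0 as δ → ∞ at fixed ξ. *)

(* Defs.v *)
From HB Require Import structures.
From mathcomp Require Import all_boot all_order all_algebra.
From mathcomp Require Import complex.
From mathcomp Require Import all_classical all_reals all_analysis.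

Set Implicit Arguments.
Unset Strict Implicit.
Unset Printing Implicit Defensive.

Import Order.TTheory GRing.Theory Num.Theory.

Local Open Scope classical_set_scope.
Local Open Scope ring_scope.

Section ProductTuple.
Context (R : realType) (n : nat).
Notation T := (measurableTypeR R).
Variable m : {sigma_finite_measure set (n.-tuple T) -> \bar R}.

Definition tuple_cons (x : T * n.-tuple T) : n.+1.-tuple T :=
  [tuple of x.1 :: x.2].

Definition lebesgue_prod_tuple : set (n.+1.-tuple T) -> \bar R :=
  pushforward (product_measure1 (@lebesgue_measure R) m) tuple_cons.

Let measurable_tuple_cons : measurable_fun setT tuple_cons.
Proof. exact: measurable_cons. Qed.

HB.instance Definition _ := Measure.copy lebesgue_prod_tuple
  (measure_function_pushforward__canonical__measure_function_Measure
     (product_measure1 (@lebesgue_measure R) m) measurable_tuple_cons).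

Let sigma_finite_lebesgue_prod_tuple : sigma_finite setT lebesgue_prod_tuple.
Proof.
have /sigma_finiteP[F [TF ndF Foo]] := sigma_finiteT (@lebesgue_measure R).
have /sigma_finiteP[G [TG ndG Goo]] := sigma_finiteT m.
pose uncons (t : n.+1.-tuple T) : T * n.-tuple T :=
  (thead t, [tuple of behead t]).
have consK : cancel tuple_cons uncons.
  by case=> x t; congr pair; apply: val_inj.
exists (fun i => uncons @^-1` (F i `*` G i)).
  rewrite -preimage_bigcup; apply/esym/seteqP; split=> // t _ /=.
  have [i _ Fi] : (\bigcup_i F i) (thead t) by rewrite -TF.
  have [j _ Gj] : (\bigcup_i G i) [tuple of behead t] by rewrite -TG.
  exists (maxn i j) => //; split => /=.
  - by move: Fi; exact/subsetPset/ndF/leq_maxl.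
  - by move: Gj; exact/subsetPset/ndG/leq_maxr.
move=> i; have [mF Fi] := Foo i; have [mG Gi] := Goo i; split.
  rewrite -[X in measurable X]setTI.
  have muncons : measurable_fun setT uncons.
    by apply: measurable_fun_pair;
      [exact: measurable_tnth | exact: measurable_behead].
  by apply: muncons => //; exact: measurableX.
rewrite /lebesgue_prod_tuple /pushforward -comp_preimage.
rewrite (_ : uncons \o tuple_cons = id); last by apply/funext => x; exact: consK.
by rewrite preimage_id product_measure1E// lte_mul_pinfty// ge0_fin_numE.
Qed.

HB.instance Definition _ := Measure_isSigmaFinite.Build _ _ _
  lebesgue_prod_tuple sigma_finite_lebesgue_prod_tuple.

End ProductTuple.

(* Lebesgue measure on R^n, as the n-fold product of the one on R; the
   zero-dimensional case is the unit mass at the empty tuple. *)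
Fixpoint lebesgue_tuple (R : realType) (n : nat) :
    {sigma_finite_measure set (n.-tuple (measurableTypeR R)) -> \bar R} :=
  match n with
  | 0 => dirac [tuple]
  | k.+1 => lebesgue_prod_tuple (lebesgue_tuple R k)
  end.

Section NonlocalStokes.
Context (R : realType) (d : nat).

Notation space := (d.-tuple (measurableTypeR R)).
Notation freq := 'cV[int]_d.
Notation mu := (@lebesgue_tuple R d).

Definition enorm (x : space) : R := Num.sqrt (\sum_(i < d) tnth x i ^+ 2).

Definition fnorm (xi : freq) : R :=
  Num.sqrt (\sum_(i < d) (xi i 0)%:~R ^+ 2).

Definition phase (xi : freq) (x : space) : R :=
  \sum_(i < d) (xi i 0)%:~R * tnth x i.

Definition omega_scaled (w : R -> R) (delta r : R) : R :=
  delta ^- (d + 2) * w (r / delta).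

Definition omegahat_scaled (hw : R -> R) (delta r : R) : R :=
  delta ^- (d + 1) * hw (r / delta).

(* Kernels live on (0,+oo): their values on (-oo,0] are unconstrained and
   never matter, the origin being Lebesgue negligible. *)
Definition nonlocal_kernel (w : R -> R) : Prop :=
  [/\ measurable_fun (`]0, +oo[%classic : set R) w,
      (forall r, 0 < r -> 0 <= w r) &
      (forall r, 1 < r -> w r = 0)].

Record kernel_assumptions (w hw : R -> R) (beta : R) : Prop := {
  omega_kernel : nonlocal_kernel w;
  omegahat_kernel : nonlocal_kernel hw;
  K1 : forall delta, 0 < delta ->
    ((2^-1)%:E * \int[mu]_x (omega_scaled w delta (enorm x) * enorm x ^+ 2)%:E
     = d%:R%:E)%E;
  K2 : forall delta, 0 < delta ->
    (\int[mu]_x (omegahat_scaled hw delta (enorm x) * enorm x)%:E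
     = d%:R%:E)%E;
  K3 : forall r s, 0 < r -> r <= s -> s < 1 ->
    s ^+ d.-1 * hw s <= r ^+ d.-1 * hw r;
  K4 : -1 < beta < 1 /\
    exists eps c, [/\ 0 < eps, 0 < c &
      forall r, 0 < r < eps -> hw r = c * r `^ (- d%:R - beta)] }.

Definition lambda_delta (w : R -> R) (delta : R) (xi : freq) : R :=
  \int[mu]_(s in [set s | enorm s <= delta])
    (omega_scaled w delta (enorm s) * (1 - cos (phase xi s))).

(* For fixed xi, b_delta tends to 0 as delta tends to +oo; hence bounds
   involving its inverse can only be uniform on bounded ranges of delta. *)
Definition b_delta (hw : R -> R) (delta : R) (xi : freq) : 'cV[R]_d :=
  \col_(i < d) \int[mu]_(s in [set s | enorm s <= delta])
    (omegahat_scaled hw delta (enorm s) * (tnth s i / enorm s)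
     * sin (phase xi s)).

(* A periodic distribution with k components is identified with the family of
   its Fourier coefficients; scalar distributions are the case k = 1. *)
Definition coeffs (k : nat) := freq -> 'cV[R[i]]_k.

(* Polynomial growth characterizes the Fourier coefficients of periodic
   distributions. *)
Definition mean_zero_periodic (k : nat) (g : coeffs k) : Prop :=
  g 0 = 0 /\
  exists (M : R) (N : nat), forall xi j,
    Normc.normc (g xi j 0) <= M * (1 + fnorm xi) ^+ N.

Definition real_valued (k : nat) (g : coeffs k) : Prop :=
  forall xi, g (- xi) = map_mx (@conjc R) (g xi).

Definition weighted_norm (k : nat) (wt : freq -> R) (g : coeffs k) : \bar R :=
  sqrte (((2 * pi) ^- d)%:E *
    \esum_(xi in [set xi : freq | xi != 0%R])
      (wt xi * \sum_(j < k) Normc.normc (g xi j 0) ^+ 2)%:E)%E.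

Definition Hs_norm (k : nat) (s : R) : coeffs k -> \bar R :=
  weighted_norm (fun xi => fnorm xi `^ (2 * s)).

Definition L2_norm (k : nat) : coeffs k -> \bar R := Hs_norm 0.

Definition energy_norm (k : nat) (w : R -> R) (delta : R) :
    coeffs k -> \bar R :=
  weighted_norm (lambda_delta w delta).

Definition dual_energy_norm (k : nat) (w : R -> R) (delta : R) :
    coeffs k -> \bar R :=
  weighted_norm (fun xi => (lambda_delta w delta xi)^-1).

Definition b_deltaC (hw : R -> R) (delta : R) (xi : freq) : 'cV[R[i]]_d :=
  map_mx (real_complex R) (b_delta hw delta xi).

Definition b_delta_sq (hw : R -> R) (delta : R) (xi : freq) : R :=
  \sum_(i < d) b_delta hw delta xi i 0 ^+ 2.

Definition nonlocal_laplacian (w : R -> R) (delta : R) (u : coeffs d) :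
    coeffs d :=
  fun xi => - (real_complex R (lambda_delta w delta xi) *: u xi).

Definition nonlocal_gradient (hw : R -> R) (delta : R) (p : coeffs 1) :
    coeffs d :=
  fun xi => 'i%C *: (b_deltaC hw delta xi *m p xi).

Definition nonlocal_divergence (hw : R -> R) (delta : R) (u : coeffs d) :
    coeffs 1 :=
  fun xi => 'i%C *: ((b_deltaC hw delta xi)^T *m u xi).

Definition stokes_solution (nu : R) (w hw : R -> R) (delta : R)
    (f u : coeffs d) (p : coeffs 1) : Prop :=
  [/\ mean_zero_periodic u, mean_zero_periodic p,
      (forall xi, - (real_complex R nu *: nonlocal_laplacian w delta u xi)
                  + nonlocal_gradient hw delta p xi = f xi) &
      (forall xi, - nonlocal_divergence hw delta u xi = 0)].

Definition stokes_symbol (nu : R) (w hw : R -> R) (delta : R) (xi : freq) :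
    'M[R[i]]_(d + 1) :=
  block_mx (real_complex R (nu * lambda_delta w delta xi))%:M
           ('i%C *: b_deltaC hw delta xi)
           (- 'i%C *: (b_deltaC hw delta xi)^T)
           0.

Definition stokes_symbol_inv (nu : R) (w hw : R -> R) (delta : R)
    (xi : freq) : 'M[R[i]]_(d + 1) :=
  let lam := lambda_delta w delta xi in
  let bb := b_deltaC hw delta xi in
  let nb := b_delta_sq hw delta xi in
  block_mx
    (real_complex R (nu * lam)^-1 *:
       (1%:M - real_complex R nb^-1 *: (bb *m bb^T)))
    (('i%C * real_complex R nb^-1) *: bb)
    ((- 'i%C * real_complex R nb^-1) *: bb^T)
    (real_complex R (- (nu * lam) / nb))%:M.

End NonlocalStokes.

(* Main.v *)
Require Import Defs.
From HB Require Import structures.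
From mathcomp Require Import all_boot all_order all_algebra.
From mathcomp Require Import complex.
From mathcomp Require Import all_classical all_reals all_analysis.
From mathcomp Require Import measurable_realfun ring lra.

(** In Fourier variables the system decouples: at a frequency xi it is the
    linear system with matrix
    [A = ((nu lambda I, i b), (- i b^T, 0))],
    where lambda and b are the symbols of the nonlocal Laplacian and gradient.
    When lambda and |b| do not vanish, a block computation
    ([stokes_symbol_mulV]) inverts A: the velocity is the projection of the
    datum on the hyperplane orthogonal to b, divided by nu lambda, and the
    pressure is [- i b^T f / |b|^2].  Hence [|u| <= |f| / (nu lambda)] and
    [|p| <= |f| / |b|], which gives both estimates mode by mode.  All the
    analysis is in the lower bounds for lambda and |b| at the nonzero integer
    frequencies; they give the invertibility of A, and, being polynomial
    in |xi|, they also ensure that the solution is again a periodic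
    distribution.

    Lower bound for lambda ([lambda_lower_bound]).  Since
    [lambda = int W(s) (1 - cos (xi . s)) ds] with W nonnegative and not
    negligible, what is needed is a form of the Riemann-Lebesgue lemma
    that is uniform in xi.  Let V be W truncated at height 1, and let P be the
    Fejer-type average [N^-2 sum_(j,l < N) cos ((j - l) xi . s)].  It is
    nonnegative, its mean over a cube of side in 2 pi Z is 1 / N, and
    [1 - P <= N^2 (1 - cos (xi . s))].  Splitting the integral of
    [V = V P + V (1 - P)] gives
    [int V <= |cube| / N + N^2 int V (1 - cos (xi . s))],
    and a large N makes the first term harmless
    ([weight_oscillation]).

    Lower bound for b ([drift_lower], [b_delta_sqrt_lower]).  Let K(s) be the
    gradient kernel at distance |s|, divided by |s|.  The function
    [L(t) = int K(s) (1 - cos (t xi . s)) ds] has derivative xi . b at t = 1.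
    Rescaling the variable gives
    [L(t) = int t^-d K(s / t) (1 - cos (xi . s)) ds], and the monotonicity
    assumption on [r^(d-1) hw(r)] says precisely that [t^-d K(s / t)] is
    nondecreasing in t.  So xi . b is nonnegative; near the origin, where
    [hw(r) = c r^(-d-beta)], the increment of [t^-d K(s / t)] is explicit, and
    it is integrated over a box on which [xi . s] is comparable to
    [|xi| |s|].  The outcome is [xi . b >= k y^(1-beta) |xi|^2] for small y
    with [y delta |xi| <= 1]; the choice of y proportional to 1 / |xi| gives
    [|b| >= c |xi|^beta], uniformly for delta bounded. *)

Set Implicit Arguments.
Unset Strict Implicit.
Unset Printing Implicit Defensive.

Import Order.TTheory GRing.Theory Num.Theory.
Import numFieldNormedType.Exports.

Local Open Scope classical_set_scope.
Local Open Scope ring_scope.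

(** * Integrals of nonnegative real functions *)

Section RealIntegrands.
Context d (S : measurableType d) (R : realType) (m : {measure set S -> \bar R}).
Implicit Types f g : S -> R.

Lemma ge0_integral_EFinZ (k : R) f : 0 <= k -> measurable_fun setT f ->
  (forall x, 0 <= f x) ->
  (\int[m]_x (k * f x)%:E = k%:E * \int[m]_x (f x)%:E)%E.
Proof.
move=> k0 mf f0; under eq_integral do rewrite EFinM.
by rewrite ge0_integralZl//; [exact/measurable_EFinP|move=> x _; rewrite lee_fin].
Qed.

Lemma ge0_integral_EFinD f g : measurable_fun setT f -> measurable_fun setT g ->
  (forall x, 0 <= f x) -> (forall x, 0 <= g x) ->
  (\int[m]_x (f x + g x)%:E = \int[m]_x (f x)%:E + \int[m]_x (g x)%:E)%E.
Proof.
move=> mf mg f0 g0; under eq_integral do rewrite EFinD.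
rewrite ge0_integralD//; first [exact/measurable_EFinP|by move=> x _; rewrite lee_fin].
Qed.

Lemma ge0_le_integral_EFin f g : measurable_fun setT f -> measurable_fun setT g ->
  (forall x, 0 <= f x) -> (forall x, f x <= g x) ->
  (\int[m]_x (f x)%:E <= \int[m]_x (g x)%:E)%E.
Proof.
move=> mf mg f0 fg; apply: ge0_le_integral => //;
  first [exact/measurable_EFinP | by move=> x _; rewrite lee_fin].
Qed.

Lemma ge0_integrable_EFin f : measurable_fun setT f -> (forall x, 0 <= f x) ->
  (\int[m]_x (f x)%:E < +oo)%E -> m.-integrable setT (EFin \o f).
Proof.
move=> mf f0 fy; apply/integrableP; split; first exact/measurable_EFinP.
rewrite (eq_integral (fun x => (f x)%:E))// => x _ /=.
by rewrite ger0_norm.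
Qed.

Lemma integrable_EFinZ (k : R) f : m.-integrable setT (EFin \o f) ->
  m.-integrable setT (EFin \o (fun x => k * f x)).
Proof. by move=> /(integrableZl measurableT k). Qed.

Lemma integrable_EFinD f g : m.-integrable setT (EFin \o f) ->
  m.-integrable setT (EFin \o g) -> m.-integrable setT (EFin \o (fun x => f x + g x)).
Proof. by move=> mf mg; exact: (integrableD measurableT mf mg). Qed.

Lemma Rintegral_sum (I : eqType) (r : seq I) (f : I -> S -> R) :
  (forall i, m.-integrable setT (EFin \o f i)) ->
  (\int[m]_s (\sum_(i <- r) f i s) = \sum_(i <- r) \int[m]_s f i s)%R.
Proof.
move=> fi; rewrite /Rintegral sum_fine; last first.
  by move=> i _; apply: integrable_fin_num => //; exact: fi.
congr fine; rewrite -integral_sum//.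
by apply: eq_integral => s _; rewrite sumEFin.
Qed.

End RealIntegrands.

(** * Trigonometric inequalities *)

Section Trig.
Context {R : realType}.
Implicit Types x t h : R.

Lemma cos_MVT (a b : R) : exists2 c, `|c - a| <= `|b - a| &
  cos b - cos a = - sin c * (b - a).
Proof.
have mvt (u v : R) : u <= v -> exists2 c, c \in `[u, v]%R &
    cos v - cos u = - sin c * (v - u).
  move=> uv; apply: (@MVT_segment _ cos (fun x => - sin x) u v uv).
  exact/continuous_subspaceT/continuous_cos.
have [/mvt[c]|/ltW /mvt[c]] := leP a b; rewrite in_itv/= => /andP[ac cb] E.
  by exists c; rewrite // !ger0_norm ?lerD2r// subr_ge0// (le_trans ac).
exists c; last by lra.
by rewrite !ler0_norm ?lerN2 ?lerD2r// subr_le0// (le_trans ac).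
Qed.

Lemma sin_lipschitz (a b : R) : `|sin b - sin a| <= `|b - a|.
Proof.
wlog ab : a b / a <= b.
  move=> H; have [/H//|/ltW ba] := leP a b.
  by rewrite distrC [leRHS]distrC; exact: H.
have [c _ ->] := @MVT_segment _ sin cos a b ab
  (fun x _ => is_derive_sin x) (continuous_subspaceT (@continuous_sin R)).
by rewrite normrM -[leRHS]mul1r; apply: ler_wpM2r => //; exact: cos_max.
Qed.

Lemma normr_sin_le x : `|sin x| <= `|x|.
Proof. by have := sin_lipschitz 0 x; rewrite sin0 !subr0. Qed.

Lemma sin_natM_le (n : nat) x : `|sin (n%:R * x)| <= n%:R * `|sin x|.
Proof.
elim: n => [|n IH]; first by rewrite !mul0r sin0 normr0.
rewrite -natr1 mulrDl mul1r sinD (le_trans (ler_normD _ _))// !normrM mulrDl mul1r.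
apply: lerD.
  apply: le_trans IH; rewrite -[leRHS]mulr1; apply: ler_wpM2l => //.
  exact: cos_max.
by rewrite -[leRHS]mul1r; apply: ler_wpM2r => //; exact: cos_max.
Qed.

Lemma onem_cos_half x : 1 - cos x = 2 * sin (x / 2) ^+ 2.
Proof.
have -> : cos x = cos ((x / 2) *+ 2) by congr cos; rewrite -mulr_natr; field.
rewrite cos_mulr2n sin2cos2; ring.
Qed.

(** As [1 - cos x = 2 sin^2 (x / 2)], this is [|sin (n x)| <= n |sin x|] with
    [n = |j - l| < N]. *)
Lemma onem_cos_mul (j l N : nat) x : (j < N)%N -> (l < N)%N ->
  1 - cos ((j%:R - l%:R) * x) <= N%:R ^+ 2 * (1 - cos x).
Proof.
wlog jl : j l / (l <= j)%N.
  move=> H jN lN; have [lj|/ltnW jl] := leqP l j; first exact: H.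
  by rewrite -(opprB l%:R j%:R) (mulNr (l%:R - j%:R)) cosN; apply: H.
move=> jN lN; rewrite -natrB// !onem_cos_half [leRHS]mulrCA ler_pM2l// -exprMn.
rewrite -(real_normK (num_real (sin _))) -[leRHS]real_normK ?num_real//.
apply: lerXn2r; rewrite ?nnegrE// normrM normr_nat -mulrA.
apply: (le_trans (sin_natM_le _ _)); apply: ler_wpM2r => //.
by rewrite ler_nat; exact: leq_trans (leq_subr _ _) (ltnW jN).
Qed.

Lemma onem_cos_ler x : 1 - cos x <= x ^+ 2 / 2.
Proof.
have := normr_sin_le (x / 2); rewrite onem_cos_half => h.
have : sin (x / 2) ^+ 2 <= (x / 2) ^+ 2.
  rewrite -(real_normK (num_real (sin _))) -[leRHS]real_normK ?num_real//.
  by apply: lerXn2r; rewrite ?nnegrE.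
lra.
Qed.

(** On the interval from 0 to 1/2 the cosine is at least 7/8, hence
    [sin y >= 7/8 y] there; with [y = |x| / 2] this gives the factor 49/128,
    which exceeds 1/4. *)
Lemma onem_cos_ger x : `|x| <= 1 -> x ^+ 2 / 4 <= 1 - cos x.
Proof.
wlog x0 : x / 0 <= x.
  move=> H; have [/H//|/ltW x0] := leP 0 x.
  by rewrite -normrN -sqrrN -cosN; apply: H; rewrite oppr_ge0.
rewrite ger0_norm// => x1; rewrite onem_cos_half.
have [c c0] := @MVT_segment _ sin cos 0 (x / 2) (divr_ge0 x0 (ler0n _ 2))
  (fun x _ => is_derive_sin x) (continuous_subspaceT (@continuous_sin R)).
rewrite sin0 !subr0 => ->.
have : 1 - cos c <= c ^+ 2 / 2 by exact: onem_cos_ler.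
move: c0; rewrite in_itv/= => /andP[c0 cx] cc.
have c78 : 7 / 8 <= cos c by nra.
have c1 := cos_le1 c.
have : (7 / 8) ^+ 2 <= cos c ^+ 2 by nra.
by nra.
Qed.

(** The increment is [h sin c] with [|c - x| <= |h|], and the sine is
    1-Lipschitz. *)
Lemma cos_taylor x h : cos x - cos (x + h) <= h * sin x + h ^+ 2.
Proof.
have [c ch E] := cos_MVT x (x + h).
have := sin_lipschitz x c; move: ch; rewrite addrAC subrr add0r => ch.
move/le_trans => /(_ _ ch) sch.
have -> : cos x - cos (x + h) = h * sin x + h * (sin c - sin x) by lra.
rewrite lerD2l (le_trans (ler_norm _))// normrM -real_normK ?num_real//.
by rewrite expr2; exact: ler_wpM2l.
Qed.

End Trig.

(** * Lebesgue measure on tuples: slicing and dilation *)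

Section LebesgueTuple.
Context (R : realType).
Notation T := (measurableTypeR R).
Notation mu := (@lebesgue_tuple R).

Lemma measurable_tuple_cons n : measurable_fun setT (@tuple_cons R n).
Proof. exact: measurable_cons. Qed.

(** The measure on (n+1)-tuples is the image of a product measure, so this is
    Tonelli's theorem; every induction on the dimension goes through it. *)
Lemma integral_tuple_cons n (f : n.+1.-tuple T -> \bar R) :
  measurable_fun [set: n.+1.-tuple T] f -> (forall x, 0 <= f x)%E ->
  (\int[mu n.+1]_x f x =
   \int[lebesgue_measure]_a \int[mu n]_t f (tuple_cons (a, t)))%E.
Proof.
move=> mf f0.
have -> : (\int[mu n.+1]_x f x = \int[pushforward
    (product_measure1 (@lebesgue_measure R) (mu n)) (@tuple_cons R n)]_x f x)%E.
  by [].
rewrite ge0_integral_pushforward//; last exact: measurable_tuple_cons.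
rewrite preimage_setT fubini_tonelli1//=.
exact: (measurableT_comp mf (@measurable_tuple_cons n)).
Qed.

(** Both sides are measures in A, hence it is enough to compare them on
    intervals. *)
Lemma lebesgue_measure_scale (c : R) (A : set T) : 0 < c -> measurable A ->
  lebesgue_measure A = (c%:E * lebesgue_measure (( *%R c) @^-1` A))%E.
Proof.
move=> c0 mA.
have mc : measurable_fun [set: T] ( *%R c : T -> T) by exact: measurable_funM.
pose c' := NngNum (ltW c0).
pose P := measure_function_pushforward__canonical__measure_function_Measure
  (@lebesgue_measure R) mc.
suff -> : lebesgue_measure A = mscale c' P A by [].
apply: lebesgue_measure_unique => //= _ [[a b]] _ <-.
rewrite /mscale /= /pushforward.
have -> : ( *%R c) @^-1` [set` `]a, b]] = [set` `]a / c, b / c]].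
  apply/seteqP; split => x /=; rewrite !in_itv/=;
  by rewrite ltr_pdivrMr// ler_pdivlMr// mulrC.
rewrite !lebesgue_measure_itv/= !lte_fin ltr_pM2r ?invr_gt0//.
case: ifPn => _; last by rewrite mule0.
by rewrite -!EFinB -EFinM -mulrBl mulrC divfK ?gt_eqF.
Qed.

Lemma integral_lebesgue_scale (c : R) (f : T -> \bar R) : 0 < c ->
  measurable_fun [set: T] f -> (forall x, 0 <= f x)%E ->
  (\int[lebesgue_measure]_x f x
   = c%:E * \int[lebesgue_measure]_x f (c * x)%R)%E.
Proof.
move=> c0 mf f0.
have mc : measurable_fun [set: T] ( *%R c : T -> T) by exact: measurable_funM.
pose c' := NngNum (ltW c0).
pose P := measure_function_pushforward__canonical__measure_function_Measure
  (@lebesgue_measure R) mc.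
transitivity (\int[mscale c' P]_x f x)%E.
  by apply: eq_measure_integral => A mA _; exact: lebesgue_measure_scale.
rewrite ge0_integral_mscale//.
have -> : (\int[P]_x f x = 
  \int[pushforward (@lebesgue_measure R) ( *%R c : T -> T)]_x f x)%E by [].
by rewrite ge0_integral_pushforward// preimage_setT.
Qed.

Lemma measurable_cons_sec n (f : n.+1.-tuple T -> \bar R) a :
  measurable_fun [set: n.+1.-tuple T] f ->
  measurable_fun [set: n.-tuple T] (fun t => f (tuple_cons (a, t))).
Proof.
move=> mf; have mc : measurable_fun [set: n.-tuple T]
    (fun t => tuple_cons (a, t)).
  by apply: (@measurable_cons _ _ _ _ (cst a) n id).
exact: (measurableT_comp mf mc).
Qed.

Lemma measurable_integral_cons n (f : n.+1.-tuple T -> \bar R) :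
  measurable_fun [set: n.+1.-tuple T] f -> (forall x, 0 <= f x)%E ->
  measurable_fun [set: T] (fun a => \int[mu n]_t f (tuple_cons (a, t)))%E.
Proof.
move=> mf f0.
apply: (@measurable_fun_fubini_tonelli_F _ _ _ _ _ (mu n)
  (fun x => f (tuple_cons x))) => //.
exact: (measurableT_comp mf (@measurable_tuple_cons n)).
Qed.

Lemma measurable_scale_tuple n (c : R) :
  measurable_fun [set: n.-tuple T] (map_tuple ( *%R c) : _ -> n.-tuple T).
Proof.
apply/measurable_fun_tnthP => i.
rewrite (_ : _ \o _ = fun x : n.-tuple T => c * tnth x i).
  by apply: measurable_funM => //; exact: measurable_tnth.
by apply/funext => x /=; rewrite tnth_map.
Qed.

Lemma integral_tuple_scale n (c : R) (f : n.-tuple T -> \bar R) : 0 < c ->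
  measurable_fun [set: n.-tuple T] f -> (forall x, 0 <= f x)%E ->
  (\int[mu n]_x f x = (c ^+ n)%:E * \int[mu n]_x f (map_tuple ( *%R c) x))%E.
Proof.
move=> c0; elim: n f => [|n IH] f mf f0.
  rewrite expr0 mul1e; apply: eq_integral => x _; congr f.
  by apply/val_inj; rewrite tuple0.
rewrite integral_tuple_cons//.
have mfc : measurable_fun setT (fun x => f (map_tuple ( *%R c) x)).
  exact: (measurableT_comp mf (@measurable_scale_tuple _ c)).
rewrite integral_tuple_cons// (integral_lebesgue_scale c0); last 2 first.
- exact: measurable_integral_cons.
- by move=> a; apply: integral_ge0.
rewrite exprS EFinM -muleA; congr (_ * _)%E; rewrite -ge0_integralZl//; last 3 first.
- exact: (measurable_integral_cons mfc).
- by move=> a _; apply: integral_ge0.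
- by rewrite lee_fin exprn_ge0// ltW.
apply: eq_integral => a _.
rewrite (IH (fun t => f (tuple_cons (c * a, t))))//.
  congr (_ * _)%E; apply: eq_integral => t _; congr f; exact: val_inj.
exact: measurable_cons_sec.
Qed.

Lemma measure_tuple_cons n (A : set T) (B : set (n.-tuple T)) :
  measurable A -> measurable B ->
  mu n.+1 [set x | A (thead x) /\ B [tuple of behead x]]
  = (lebesgue_measure A * mu n B)%E.
Proof.
move=> mA mB; rewrite -product_measure1E//.
rewrite [LHS]/= /lebesgue_prod_tuple /pushforward /=.
congr product_measure1; apply/seteqP; split => -[a t] /=.
  by move=> []; rewrite theadE (_ : [tuple of _] = t)//; exact: val_inj.
by move=> []; rewrite theadE (_ : [tuple of _] = t)//; exact: val_inj.
Qed.

End LebesgueTuple.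

(** * Boxes, spheres and plane waves *)

Section Boxes.
Context (R : realType).
Notation T := (measurableTypeR R).
Notation mu := (@lebesgue_tuple R).

Definition box n (A : 'I_n -> set T) : set (n.-tuple T) :=
  [set s | forall i, A i (tnth s i)].

Lemma measurable_box n (A : 'I_n -> set T) :
  (forall i, measurable (A i)) -> measurable (box A).
Proof.
move=> mA.
rewrite (_ : box A = \bigcap_(i in [set: 'I_n]) ((@tnth n T ^~ i) @^-1` A i)).
  apply: fin_bigcap_measurable => // i _; rewrite -[X in measurable X]setTI.
  by apply: measurable_tnth.
by apply/seteqP; split=> s /= h i; [move=> _|]; exact: h.
Qed.

Lemma box_cons n (A : 'I_n.+1 -> set T) (a : T) (t : n.-tuple T) :
  box A (tuple_cons (a, t)) <-> A ord0 a /\ box (fun i => A (lift ord0 i)) t.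
Proof.
split=> [h|[h0 h] i].
  split; first by have := h ord0.
  by move=> i; have := h (lift ord0 i); rewrite tnthS.
by case: (unliftP ord0 i) => [j|] ->; rewrite ?tnthS//; exact: h.
Qed.

Lemma measure_box n (A : 'I_n -> set T) (l : 'I_n -> R) :
  (forall i, measurable (A i)) -> (forall i, lebesgue_measure (A i) = (l i)%:E) ->
  mu n (box A) = (\prod_i l i)%:E.
Proof.
elim: n A l => [|n IH] A l mA lA.
  rewrite big_ord0 /= diracE mem_set//= => -[].
  by case.
rewrite big_ord_recl EFinM -lA -(IH (fun i => A (lift ord0 i)))//.
rewrite -measure_tuple_cons//; last exact: measurable_box.
congr (mu _ _); apply/seteqP; split => s /=.
  by rewrite {1}[s]tuple_eta; move/box_cons.
by rewrite [X in box A X]tuple_eta => h; exact/box_cons.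
Qed.

Lemma measurable_fun_sum_sqr n :
  measurable_fun [set: n.-tuple T] (fun s => \sum_(i < n) tnth s i ^+ 2).
Proof.
apply: measurable_sum => i; apply: measurable_funX; exact: measurable_tnth.
Qed.

Lemma measurable_sphere n (c : R) :
  measurable [set s : n.-tuple T | \sum_(i < n) tnth s i ^+ 2 = c].
Proof.
rewrite -[X in measurable X]setTI.
exact: (@measurable_fun_sum_sqr n measurableT [set c]).
Qed.

(** The slice of a sphere at a given first coordinate is a sphere of one
    dimension less, of possibly imaginary radius; in dimension one a sphere has
    at most two points. *)
Lemma sphere_negligible n (c : R) :
  mu n.+1 [set s | \sum_(i < n.+1) tnth s i ^+ 2 = c] = 0%E.
Proof.
elim: n c => [|n IH] c.
  set S := [set s | _].
  pose A : set T := [set Num.sqrt c] `|` [set - Num.sqrt c].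
  have mA : measurable A by exact: measurableU.
  apply/eqP; rewrite eq_le measure_ge0 andbT.
  apply: (@le_trans _ _ (mu 1 (box (fun=> A)))).
    apply: le_measure; rewrite ?inE; [exact: measurable_sphere|exact: measurable_box|].
    move=> s; rewrite /S/= big_ord_recl big_ord0 addr0 => sc i; rewrite ord1 /A/=.
    rewrite -sc sqrtr_sqr; case: (ger0P (tnth s ord0)) => _; [left|right] => //.
    by rewrite opprK.
  have A0 : lebesgue_measure A = 0%E.
    have s0 (x : R) : lebesgue_measure ([set x] : set T) = 0%E.
      exact: lebesgue_measure_set1.
    by rewrite /A measureU0//; exact: s0.
  by rewrite (@measure_box _ _ (fun=> 0))// big_ord_recl mul0r.
rewrite [LHS]/= /lebesgue_prod_tuple /pushforward /product_measure1.
apply: integral0_eq => a _; rewrite /= -[RHS](IH (c - a ^+ 2)).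
have E (t : n.+1.-tuple T) : \sum_(i < n.+2) tnth (tuple_cons (a, t)) i ^+ 2 =
    a ^+ 2 + \sum_(i < n.+1) tnth t i ^+ 2.
  rewrite big_ord_recl; congr (_ + _).
  by apply: eq_bigr => i _; rewrite tnthS.
by congr (mu n.+1 _); apply/seteqP; split => t /=;
  rewrite /xsection/= in_setE/= E => h; lra.
Qed.

Lemma sin_int_pi (k : int) : sin (k%:~R * pi : R) = 0.
Proof.
have H (n : nat) : sin (n%:R * pi : R) = 0.
  elim: n => [|n IH]; first by rewrite mul0r sin0.
  by rewrite -natr1 mulrDl mul1r sinDpi IH oppr0.
case: k => n; first exact: H.
by rewrite NegzE rmorphN mulNr sinN /= H oppr0.
Qed.

(** For k nonzero the hypothesis says that the interval consists of whole
    periods, so that [sin (c + k x) / k] takes the same value at both ends. *)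
Lemma integral_itv_cos (k : int) (c L : R) : 0 < L -> sin (k%:~R * L) = 0 ->
  (\int[lebesgue_measure]_(x in `[(- L)%R, L]) (1 + cos (c + k%:~R * x))%:E =
   (2 * L * (if k == 0 then 1 + cos c else 1))%:E)%E.
Proof.
move=> L0 sL; case: eqP => [->|/eqP k0].
  under eq_integral do rewrite mul0r addr0.
  rewrite integral_cst//= lebesgue_measure_itv/= lte_fin gtrN// -EFinB -EFinM.
  by congr EFin; ring.
have k0R : k%:~R != 0 :> R by rewrite intr_eq0.
pose F (x : R) := x + sin (c + k%:~R * x) / k%:~R.
have dF (x : R) : is_derive x 1 F (1 + cos (c + k%:~R * x)).
  rewrite /F; apply: is_derive_eq.
  by rewrite /GRing.scale /=; field.
have cF : continuous F.
  by move=> y; apply/differentiable_continuous/derivable1_diffP/ex_derive.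
rewrite (@continuous_FTC2 _ _ F).
- rewrite -EFinB; congr EFin; rewrite /F mulrN sinB sinD sL; field.
  exact: k0R.
- by rewrite gtrN.
- apply: continuous_subspaceT => y.
  apply: continuousD; first exact: cst_continuous.
  apply: continuous_comp; last exact: continuous_cos.
  apply: continuousD; first exact: cst_continuous.
  by apply: continuousM; [exact: cst_continuous|exact: id].
- split; first by move=> y _; exact: ex_derive.
    exact/cvg_at_right_filter/cF.
  exact/cvg_at_left_filter/cF.
- by move=> y _; rewrite derive1E; exact: derive_val.
Qed.

Lemma indic_box_cons n (A : 'I_n.+1 -> set T) (a : T) (t : n.-tuple T) :
  \1_(box A) (tuple_cons (a, t)) =
  \1_(A ord0) a * \1_(box (fun i => A (lift ord0 i))) t :> R.
Proof.
rewrite !indicE -natrM mulnb; congr (nat_of_bool _)%:R.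
apply/idP/andP => [|[]]; rewrite !in_setE; first by move/box_cons.
by move=> h1 h2; apply/box_cons.
Qed.

Lemma integral_indicM (D : set T) (g : T -> R) :
  (\int[lebesgue_measure]_a (\1_D a * g a)%:E =
   \int[lebesgue_measure]_(a in D) (g a)%:E)%E.
Proof.
rewrite [RHS]integral_mkcond; apply: eq_integral => a _.
by rewrite /patch indicE; case: ifP => _; rewrite ?mul1r ?mul0r.
Qed.

Lemma measurable_linear_form n (x : 'I_n -> R) :
  measurable_fun [set: n.-tuple T] (fun s => \sum_(i < n) x i * tnth s i).
Proof.
apply: measurable_sum => i; apply: measurable_funM => //; exact: measurable_tnth.
Qed.

Lemma measurable_onep_cos d (S : measurableType d) (c : R) (g : S -> R) :
  measurable_fun setT g -> measurable_fun setT (fun s => 1 + cos (c + g s)).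
Proof.
move=> mg; apply: measurable_funD => //.
apply: (measurableT_comp (continuous_measurable_fun (@continuous_cos R))).
exact: measurable_funD.
Qed.

Lemma onep_cos_ge0 (x : R) : 0 <= 1 + cos x.
Proof. by have := cos_geN1 x; lra. Qed.

Lemma measurable_box_cos n (x : 'I_n -> int) (c L : R) :
  measurable_fun [set: n.-tuple T]
  (fun s => (\1_(box (fun=> `[- L, L]%classic)) s *
      (1 + cos (c + \sum_(i < n) (x i)%:~R * tnth s i)))%:E).
Proof.
apply/measurable_EFinP; apply: measurable_funM.
  by apply: measurable_indic; exact: measurable_box.
apply: measurable_onep_cos. exact: (measurable_linear_form (fun i => (x i)%:~R)).
Qed.

(** Plane waves with nonzero integer frequency have mean zero over a cube
    whose side is a multiple of the period.  Adding 1 makes the integrand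
    nonnegative, so that Tonelli's theorem suffices; the phase c is there for
    the induction, because slicing at the first coordinate a turns it into
    [c + x_0 a]. *)
Lemma integral_box_cos n (x : 'I_n -> int) (c L : R) : 0 < L ->
  (forall i, sin ((x i)%:~R * L) = 0) ->
  (\int[mu n]_s (\1_(box (fun=> `[- L, L]%classic)) s *
      (1 + cos (c + \sum_(i < n) (x i)%:~R * tnth s i)))%:E
  = ((2 * L) ^+ n * (if [forall i, x i == 0] then 1 + cos c else 1))%:E)%E.
Proof.
move=> L0; elim: n x c => [|n IH] x c sx.
  rewrite expr0 mul1r /= integral_dirac//=; last exact: measurable_box_cos.
  rewrite /dirac indicE in_setT mul1e big_ord0 addr0.
  case: ifPn => [_|/forallPn[[]]//].
  by rewrite indicE mem_set ?mul1r// => -[].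
have mf := measurable_box_cos x c L.
rewrite integral_tuple_cons; [|exact: mf|]; last first.
  by move=> s; rewrite lee_fin mulr_ge0// onep_cos_ge0.
set y := fun i : 'I_n => x (lift ord0 i).
transitivity (\int[lebesgue_measure]_a (\1_(`[- L, L]%classic) a *
  ((2 * L) ^+ n * (if [forall i, y i == 0%R]
     then 1 + cos (c + (x ord0)%:~R * a) else 1)))%:E)%E.
  apply: eq_integral => a _; rewrite EFinM -IH; last by move=> i; exact: sx.
  rewrite -ge0_integralZl; first last.
  - by rewrite lee_fin.
  - by move=> s _; rewrite lee_fin mulr_ge0// onep_cos_ge0.
  - exact: (measurable_box_cos y).
  - exact: measurableT.
  apply: eq_integral => t _; rewrite -EFinM indic_box_cons -mulrA big_ord_recl.
  congr (EFin (_ * (_ * (_ + cos _)))); rewrite addrA; congr (_ + _).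
  by apply: eq_bigr => i _; rewrite tnthS.
have L2 : 0 <= 2 * L by rewrite mulr_ge0// ltW.
rewrite integral_indicM; case: (boolP [forall i, y i == 0]) => /= [/forallP
  y0|/forallPn[i yi]].
  under eq_integral do rewrite EFinM.
  rewrite ge0_integralZl; first last.
  - by rewrite lee_fin exprn_ge0.
  - by move=> s _; rewrite lee_fin onep_cos_ge0.
  - apply/measurable_EFinP; apply: measurable_funTS.
    apply: (@measurable_onep_cos _ T c (fun a => (x ord0)%:~R * a)).
    exact: measurable_funM.
  - exact: measurable_itv.
  rewrite integral_itv_cos// -EFinM; congr EFin.
  have -> : [forall i, x i == 0] = (x ord0 == 0).
    apply/forallP/eqP => [/(_ ord0)/eqP//|x0 i].
    by case: (unliftP ord0 i) => [j|] ->; rewrite ?x0//; exact: y0.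
  by move: (if _ then _ else _) => e; rewrite exprSr; ring.
rewrite [X in (if X then _ else _)](_ : _ = false); last first.
  by apply/negbTE/forallPn; exists (lift ord0 i).
under eq_integral do rewrite mulr1.
rewrite integral_cst//= lebesgue_measure_itv/= lte_fin gtrN// -EFinB -EFinM.
by congr EFin; rewrite exprSr mulr1; congr (_ * _); ring.
Qed.
End Boxes.

(** * A uniform Riemann-Lebesgue estimate *)

Section Osc.
Context (R : realType).
Notation T := (measurableTypeR R).
Notation mu := (@lebesgue_tuple R).

(** Both sides are [|sum_j exp (i j t)|^2]; in particular the left-hand side
    is nonnegative. *)
Lemma fejer_sum (N : nat) (t : R) :
  \sum_(p : 'I_N * 'I_N) cos ((p.1%:R - p.2%:R) * t)
  = (\sum_(j < N) cos (j%:R * t)) ^+ 2 + (\sum_(j < N) sin (j%:R * t)) ^+ 2.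
Proof.
rewrite !expr2 !mulr_suml -big_split/=.
rewrite -(pair_bigA _ (fun i j : 'I_N => cos ((i%:R - j%:R) * t)))/=.
apply: eq_bigr => j _; rewrite !mulr_sumr -big_split/=.
by apply: eq_bigr => l _; rewrite mulrBl cosB.
Qed.

(** With Z the sum in [fejer_sum], write [N^2 v = v Z + v (N^2 - Z)]; then
    [v Z <= Z], and [N^2 - Z] is a sum of N^2 terms [1 - cos ((j - l) t)], each
    at most [N^2 (1 - cos t)]. *)
Lemma fejer_lower (N : nat) (t v : R) : 0 <= v <= 1 ->
  N%:R ^+ 2 + N%:R ^+ 2 * v <=
  \sum_(p : 'I_N * 'I_N) (1 + cos ((p.1%:R - p.2%:R) * t))
  + N%:R ^+ 4 * (v * (1 - cos t)).
Proof.
move=> /andP[v0 v1].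
have cN : \sum_(p : 'I_N * 'I_N) (1 : R) = N%:R ^+ 2.
  by rewrite sumr_const card_prod card_ord -natrX.
rewrite big_split/= cN.
set Z := \sum_(p : 'I_N * 'I_N) cos _.
have Z0 : 0 <= Z by rewrite /Z fejer_sum addr_ge0// sqr_ge0.
have ZN : N%:R ^+ 2 - Z <= N%:R ^+ 4 * (1 - cos t).
  rewrite -cN /Z -sumrB.
  apply: (@le_trans _ _ (\sum_(p : 'I_N * 'I_N) N%:R ^+ 2 * (1 - cos t))).
    by apply: ler_sum => p _; exact: onem_cos_mul.
  rewrite sumr_const card_prod card_ord -[leLHS]mulr_natl natrM mulrA.
  by rewrite -expr2 -exprD.
nra.
Qed.

Lemma count_diag (N : nat) (b : R) :
  \sum_(p : 'I_N * 'I_N) (b * (if p.1 == p.2 then 2 else 1)) = b * (N%:R ^+ 2 + N%:R).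
Proof.
rewrite -mulr_sumr; congr (_ * _).
rewrite -(pair_bigA _ (fun i j : 'I_N => if i == j then 2 else 1 : R))/=.
rewrite (eq_bigr (fun=> N%:R + 1)).
  by rewrite sumr_const card_ord -mulr_natr; ring.
move=> i _; rewrite (bigD1 i)//= eqxx (eq_bigr (fun=> 1)).
  rewrite sumr_const cardC1 card_ord -addn1.
  by case: N i => [[]//|N i]; rewrite -subn1 addn1 subSS subn0 -[N.+1]addn1 natrD; ring.
by move=> j /negbTE; rewrite eq_sym => ->.
Qed.

(** A weight bounded by 1 on a cube cannot concentrate on the set where
    [cos (x . s)] is close to 1, uniformly in the nonzero integer frequency x.
    This is [fejer_lower] integrated against the cube: only the N diagonal
    terms of the double sum have a nonzero mean. *)
Lemma weight_oscillation n (V : n.-tuple T -> R) (x : 'I_n -> int) (L : R) (N : nat) :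
  0 < L -> (forall k : int, sin (k%:~R * L) = 0) -> (0 < N)%N ->
  (exists i, x i != 0) ->
  measurable_fun [set: n.-tuple T] V ->
  (forall s, 0 <= V s <= \1_(box (fun=> `[- L, L]%classic)) s) ->
  (\int[mu n]_s (V s)%:E <= ((2 * L) ^+ n / N%:R)%:E + (N%:R ^+ 2)%:E *
    \int[mu n]_s (V s * (1 - cos (\sum_(i < n) (x i)%:~R * tnth s i)))%:E)%E.
Proof.
move=> L0 sL N0 [i0 xi0] mV VQ.
set q := (2 * L) ^+ n.
pose Q : set (n.-tuple T) := box (fun=> `[- L, L]%classic).
pose th (s : n.-tuple T) := \sum_(i < n) (x i)%:~R * tnth s i.
have mQ : measurable Q by exact: measurable_box.
have m1Q : measurable_fun [set: n.-tuple T] (\1_Q : _ -> R).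
  exact: measurable_indic.
have muQ : mu n Q = q%:E.
  rewrite (@measure_box _ _ _ (fun=> 2 * L))//.
    by rewrite prodr_const card_ord.
  by move=> i; rewrite lebesgue_measure_itv/= lte_fin gtrN// -EFinB; congr EFin; ring.
have V0 s : 0 <= V s by have /andP[] := VQ s.
have VQ1 s : V s <= \1_Q s by have /andP[] := VQ s.
have mW : measurable_fun [set: n.-tuple T] (fun s => V s * (1 - cos (th s))).
  apply: measurable_funM => //; apply: measurable_funB => //.
  apply: (measurableT_comp (continuous_measurable_fun (@continuous_cos R))).
  exact: (measurable_linear_form (fun i => (x i)%:~R)).
have W0 s : 0 <= V s * (1 - cos (th s)).
  by rewrite mulr_ge0// subr_ge0 cos_le1.
have i1Q : (\int[mu n]_s (\1_Q s)%:E = q%:E)%E.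
  by rewrite integral_indic// setIT.
have Vq : (\int[mu n]_s (V s)%:E <= q%:E)%E.
  by rewrite -i1Q; apply: ge0_le_integral_EFin.
have NR : 0 < N%:R :> R by rewrite ltr0n.
have N2 : 0 <= N%:R ^+ 2 :> R by rewrite exprn_ge0.
have N4 : 0 <= N%:R ^+ 4 :> R by rewrite exprn_ge0.
(* the terms of the double sum; the 0 is the phase of [integral_box_cos] *)
pose G (p : 'I_N * 'I_N) (s : n.-tuple T) : R :=
  \1_Q s * (1 + cos (0 + \sum_(i < n) (((p.1 : nat)%:Z - (p.2 : nat)%:Z) * x i)%:~R *
    tnth s i)).
have G0 p s : 0 <= G p s by rewrite mulr_ge0// onep_cos_ge0.
have mG p : measurable_fun [set: n.-tuple T] (G p).
  have := measurable_box_cos (fun i => ((p.1 : nat)%:Z - (p.2 : nat)%:Z) * x i) 0 L.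
  by move/measurable_EFinP.
have iG p : (\int[mu n]_s (G p s)%:E = (q * if p.1 == p.2 then 2 else 1)%:E)%E.
  rewrite integral_box_cos//; congr (_ * _)%:E.
  rewrite cos0; congr (if _ then _ else _).
  apply/forallP/eqP => [/(_ i0)|-> i]; last by rewrite subrr mul0r.
  rewrite mulf_eq0 (negbTE xi0) orbF subr_eq0 => /eqP[] h; exact: val_inj.
have key : (\int[mu n]_s (N%:R ^+ 2 * \1_Q s + N%:R ^+ 2 * V s)%:E <=
    \int[mu n]_s (\sum_p G p s + N%:R ^+ 4 * (V s * (1 - cos (th s))))%:E)%E.
  apply: ge0_le_integral_EFin.
  - by apply: measurable_funD; apply: measurable_funM.
  - apply: measurable_funD; [exact: measurable_sum|exact: measurable_funM].
  - by move=> s; rewrite addr_ge0 ?mulr_ge0.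
  - move=> s; have := VQ1 s; have := V0 s; rewrite /G indicE.
    case: (s \in Q) => V0s V1s.
      rewrite mulr1 (le_trans (@fejer_lower N (th s) (V s) _)) ?V0s//.
      rewrite lerD2r; apply: ler_sum => p _; rewrite mul1r lerD2l.
      rewrite add0r /th mulr_sumr le_eqVlt; apply/orP; left; apply/eqP.
      congr cos; apply: eq_bigr => i _.
      by rewrite intrM intrB mulrA.
    have -> : V s = 0 by apply/eqP; rewrite eq_le V0s V1s.
    by rewrite !(mulr0, mul0r, addr0) sumr_ge0// => p _; rewrite mul0r.
have iS : (\int[mu n]_s (\sum_p G p s)%:E = (q * (N%:R ^+ 2 + N%:R))%:E)%E.
  under eq_integral do rewrite -sumEFin.
  rewrite ge0_integral_sum//; last 2 first.
  - by move=> p; exact/measurable_EFinP.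
  - by move=> p s _; rewrite lee_fin.
  by rewrite -count_diag -sumEFin; apply: eq_bigr.
move: key; rewrite ge0_integral_EFinD;
  [|exact: measurable_funM|exact: measurable_funM
   |by move=> s; rewrite mulr_ge0|by move=> s; rewrite mulr_ge0].
rewrite ge0_integral_EFinD;
  [|exact: measurable_sum|exact: measurable_funM
   |by move=> s; rewrite sumr_ge0|by move=> s; rewrite mulr_ge0].
rewrite !ge0_integral_EFinZ// i1Q iS.
have : (0 <= \int[mu n]_s (V s * (1 - cos (th s)))%:E)%E.
  by apply: integral_ge0 => s _; rewrite lee_fin.
have : (0 <= \int[mu n]_s (V s)%:E)%E.
  by apply: integral_ge0 => s _; rewrite lee_fin.
move: Vq; case: (\int[mu n]_s (V s)%:E)%E => [a|//|//] _ _.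
case: (\int[mu n]_s (V s * (1 - cos (th s)))%:E)%E => [b|_ _|//]; last first.
  by rewrite gt0_muley ?lte_fin ?exprn_gt0// addey// leey.
rewrite -!EFinM -!EFinD !lee_fin => _ h.
rewrite -(ler_pM2l (exprn_gt0 2 NR)).
rewrite [leRHS](_ : _ = q * N%:R + N%:R ^+ 4 * b); first lra.
by field; rewrite gt_eqF.
Qed.
End Osc.

(** * Euclidean norms and phases *)

Section CauchySchwarz.
Context (R : realFieldType).

(** With A, B, C the three sums, [sum_i (B a_i - C b_i)^2 = B (A B - C^2)] is
    nonnegative. *)
Lemma cauchy_schwarz (I : finType) (a b : I -> R) :
  (\sum_i a i * b i) ^+ 2 <= (\sum_i a i ^+ 2) * (\sum_i b i ^+ 2).
Proof.
set A := \sum_i a i ^+ 2; set B := \sum_i b i ^+ 2; set C := \sum_i a i * b i.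
have B0 : 0 <= B by apply: sumr_ge0 => i _; exact: sqr_ge0.
have [B00|Bn0] := eqVneq B 0.
  have b0 i : b i = 0.
    have /psumr_eq0P : \sum_i b i ^+ 2 = 0 by [].
    move=> /(_ (fun i _ => sqr_ge0 (b i)) i isT)/eqP.
    by rewrite sqrf_eq0 => /eqP.
  by rewrite /C big1 ?expr0n/= ?mulr_ge0// ?sumr_ge0// => i _; rewrite ?b0 ?mulr0 ?sqr_ge0.
have Bp : 0 < B by rewrite lt_def Bn0.
have : 0 <= \sum_i (B * a i - C * b i) ^+ 2 by apply: sumr_ge0 => i _; exact: sqr_ge0.
rewrite (eq_bigr (fun i => B ^+ 2 * a i ^+ 2 - 2 * B * C * (a i * b i)
   + C ^+ 2 * b i ^+ 2)); last by move=> i _; ring.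
rewrite big_split/= sumrB -!mulr_sumr -/A -/B -/C => h.
rewrite -subr_ge0 -(pmulr_rge0 _ Bp).
have -> : B * (A * B - C ^+ 2) = B ^+ 2 * A - 2 * B * C * C + C ^+ 2 * B.
  by ring.
exact: h.
Qed.
End CauchySchwarz.

Lemma sqrt_sum_sqr_le (R : rcfType) (I : finType) (a : I -> R) :
  Num.sqrt (\sum_i a i ^+ 2) <= \sum_i `|a i|.
Proof.
have S0 : 0 <= \sum_i `|a i| by apply: sumr_ge0.
rewrite -(@ler_pXn2r _ 2)// ?nnegrE ?sqrtr_ge0// sqr_sqrtr; last first.
  by apply: sumr_ge0 => i _; exact: sqr_ge0.
rewrite expr2 mulr_suml; apply: ler_sum => i _.
rewrite -real_normK ?num_real// expr2; apply: ler_wpM2l => //.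
by rewrite (bigD1 i)//= lerDl sumr_ge0.
Qed.

Section Norms.
Context (R : realType) (d : nat).
Notation T := (measurableTypeR R).
Notation space := (d.-tuple T).
Notation freq := 'cV[int]_d.

Lemma enorm_ge0 (s : space) : 0 <= enorm s.
Proof. exact: sqrtr_ge0. Qed.

Lemma fnorm_ge0 (xi : freq) : 0 <= fnorm R xi.
Proof. exact: sqrtr_ge0. Qed.

Lemma enorm_sqr (s : space) : enorm s ^+ 2 = \sum_(i < d) tnth s i ^+ 2.
Proof. by rewrite sqr_sqrtr// sumr_ge0// => i _; exact: sqr_ge0. Qed.

Lemma fnorm_sqr (xi : freq) :
  fnorm R xi ^+ 2 = \sum_(i < d) (xi i 0)%:~R ^+ 2.
Proof. by rewrite sqr_sqrtr// sumr_ge0// => i _; exact: sqr_ge0. Qed.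

Lemma measurable_enorm : measurable_fun [set: space] (@enorm R d).
Proof.
apply: (measurableT_comp (continuous_measurable_fun (@sqrt_continuous R))).
exact: measurable_fun_sum_sqr.
Qed.

Lemma measurable_phase (xi : freq) : measurable_fun [set: space] (phase xi).
Proof. exact: (measurable_linear_form (fun i => (xi i 0)%:~R)). Qed.

Lemma measurable_cos_phase (xi : freq) :
  measurable_fun [set: space] (fun s => cos (phase xi s)).
Proof.
apply: (measurableT_comp (continuous_measurable_fun (@continuous_cos R))).
exact: measurable_phase.
Qed.

Lemma phase_le (xi : freq) (s : space) : `|phase xi s| <= fnorm R xi * enorm s.
Proof.
rewrite -(@ler_pXn2r _ 2)// ?nnegrE ?mulr_ge0 ?sqrtr_ge0//.
rewrite real_normK ?num_real// exprMn enorm_sqr fnorm_sqr.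
exact: (@cauchy_schwarz R 'I_d (fun i => (xi i 0)%:~R) (tnth s)).
Qed.

Lemma coord_le (s : space) i : `|tnth s i| <= enorm s.
Proof.
rewrite -(@ler_pXn2r _ 2)// ?nnegrE ?sqrtr_ge0// real_normK ?num_real//.
rewrite enorm_sqr (bigD1 i)//= lerDl sumr_ge0// => j _; exact: sqr_ge0.
Qed.

Lemma freq_neq0 (xi : freq) : xi != 0 -> exists i, xi i 0 != 0.
Proof.
move=> xi0; apply/existsP; apply: contraNT xi0 => /existsPn h.
apply/eqP/matrixP => i j; rewrite ord1 mxE; apply/eqP.
by have := h i; rewrite negbK.
Qed.

Lemma fnorm_ge1 (xi : freq) : xi != 0 -> 1 <= fnorm R xi.
Proof.
move=> /freq_neq0[i xi0]; rewrite -(@ler_pXn2r _ 2)// ?nnegrE ?sqrtr_ge0//.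
rewrite expr1n fnorm_sqr (bigD1 i)//=.
apply: (@le_trans _ _ ((xi i 0)%:~R ^+ 2)).
  rewrite -real_normK ?num_real// -[leLHS](expr1n _ 2).
  by apply: lerXn2r; rewrite ?nnegrE// -intr_norm ler1z -gtz0_ge1 normr_gt0.
by rewrite lerDl sumr_ge0// => j _; exact: sqr_ge0.
Qed.

Lemma enorm_scale (c : R) (s : space) : 0 <= c ->
  enorm (map_tuple ( *%R c) s : space) = c * enorm s.
Proof.
move=> c0; rewrite /enorm -{2}(ger0_norm c0) -sqrtr_sqr -sqrtrM ?sqr_ge0//.
by congr Num.sqrt; rewrite mulr_sumr; apply: eq_bigr => i _; rewrite tnth_map exprMn.
Qed.

Lemma phase_scale (c : R) (xi : freq) (s : space) :
  phase xi (map_tuple ( *%R c) s : space) = c * phase xi s.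
Proof.
by rewrite /phase mulr_sumr; apply: eq_bigr => i _; rewrite tnth_map mulrCA.
Qed.

Lemma phaseN (xi : freq) (s : space) : phase (- xi) s = - phase xi s.
Proof.
by rewrite /phase -sumrN; apply: eq_bigr => i _; rewrite mxE rmorphN mulNr.
Qed.

End Norms.

(** * Radial kernels *)

Section Radial.
Context (R : realType) (d : nat).
Notation T := (measurableTypeR R).
Notation space := (d.-tuple T).
Notation freq := 'cV[int]_d.
Notation mu := (@lebesgue_tuple R d).

Definition cutoff (i : interval R) (k : R -> R) (r : R) : R :=
  if r \in i then k r else 0.

(** The kernel k at interaction length delta, with a power of delta as
    normalization.  The profile k is measurable on the positive radii only;
    cut to an interval of positive radii, it gives a measurable function on the
    whole space. *)
Definition density (i : interval R) (k : R -> R) (n : nat) (delta : R) (s : space) : R :=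
  delta ^- n * cutoff i k (enorm s / delta).

Lemma measurable_density (i : interval R) (k : R -> R) n (delta : R) :
  nonlocal_kernel k -> {subset i <= `]0%R, +oo[%R} ->
  measurable_fun [set: space] (density i k n delta).
Proof.
move=> [mk _ _] i0.
have mki : measurable_fun [set: T] (cutoff i k : T -> T).
  rewrite (_ : cutoff i k = k \_ [set` i]); last first.
    by apply/funext => r; rewrite /patch /cutoff mem_setE.
  apply/(measurable_restrictT k (measurable_itv i)).
  by apply: measurable_funS mk => // r /= ri; exact: i0.
apply: measurable_funM => //; apply: (measurableT_comp mki).
by apply: measurable_funM => //; exact: measurable_enorm.
Qed.

Lemma density_ge0 (i : interval R) (k : R -> R) n (delta : R) s :
  nonlocal_kernel k -> {subset i <= `]0%R, +oo[%R} -> 0 < delta ->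
  0 <= density i k n delta s.
Proof.
move=> [_ k0 _] i0 d0; apply: mulr_ge0.
  by rewrite invr_ge0 exprn_ge0// ltW.
rewrite /cutoff; case: ifPn => [/i0|_]; last exact: lexx.
by rewrite in_itv/= andbT; exact: k0.
Qed.

(** The factor g absorbs the arbitrary value of the kernel at the origin. *)
Lemma density_closed (k : R -> R) (n : nat) (delta : R) (g : space -> R) (s : space) :
  0 < delta -> nonlocal_kernel k -> (enorm s = 0 -> g s = 0) ->
  delta ^- n * k (enorm s / delta) * g s = density `]0, 1] k n delta s * g s.
Proof.
move=> d0 [_ _ k1] g0; rewrite /density /cutoff.
have [/g0 ->|s0] := eqVneq (enorm s) 0; first by rewrite !mulr0.
have sp : 0 < enorm s / delta by rewrite divr_gt0// lt_def s0 enorm_ge0.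
by case: ifPn => //; rewrite in_itv/= sp/= -ltNge => /k1 ->.
Qed.

(** The whole space and the closed ball are the two domains of interest: the
    first one for the moments of the kernels, the second one for the symbols.
    The cut is at the open interval because the monotonicity of the gradient
    kernel is only known below radius 1; the sphere of radius delta, where the
    cut may change the integrand, is negligible. *)
Lemma integral_kernel (D : set space) (k : R -> R) (n : nat) (delta : R)
    (g : space -> R) :
  (0 < d)%N -> 0 < delta -> nonlocal_kernel k -> measurable_fun [set: space] g ->
  (forall s, enorm s = 0 -> g s = 0) ->
  measurable D -> (forall s, enorm s < delta -> D s) ->
  (\int[mu]_(s in D) (delta ^- n * k (enorm s / delta) * g s)%:E
   = \int[mu]_s (density `]0, 1[ k n delta s * g s)%:E)%E.
Proof.
move=> d_gt0 d0 kk mg g0 mD ballD.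
have sub1 : {subset (`]0, 1] : interval R) <= (`]0, +oo[ : interval R)}.
  by move=> r; rewrite !in_itv/= andbT => /andP[].
have sub2 : {subset (`]0, 1[ : interval R) <= (`]0, +oo[ : interval R)}.
  by move=> r; rewrite !in_itv/= andbT => /andP[].
transitivity (\int[mu]_(s in D) (density `]0, 1] k n delta s * g s)%:E)%E.
  by apply: eq_integral => s _; rewrite density_closed// => /g0.
have mc : measurable_fun [set: space] (fun s => (density `]0, 1] k n delta s * g s)%:E).
  by apply/measurable_EFinP/measurable_funM => //; exact: measurable_density.
rewrite integral_mkcond; apply: ae_eq_integral => //.
- by apply/(measurable_restrictT _ mD); exact: measurable_funTS.
- by apply/measurable_EFinP/measurable_funM => //; exact: measurable_density.
(* the exceptional set is the sphere of radius delta *)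
exists [set s : space | \sum_(i < d) tnth s i ^+ 2 = delta ^+ 2]; split.
- exact: measurable_sphere.
- by case: d d_gt0 => // m _; exact: sphere_negligible.
- move=> s /=; apply: contra_notP => /eqP sd _.
  have {}sd : enorm s / delta != 1.
    apply: contra_neq sd => /(congr1 (fun x => x * delta)).
    by rewrite mul1r divfK ?gt_eqF// -enorm_sqr => ->.
  have E : density `]0, 1] k n delta s = density `]0, 1[ k n delta s.
    by rewrite /density /cutoff !in_itv/= le_eqVlt (negbTE sd).
  rewrite /patch E; case: ifPn => //; rewrite notin_setE => sD.
  rewrite /density /cutoff ifF ?mulr0 ?mul0r//.
  apply: contra_notF sD; rewrite in_itv/= => /andP[_].
  by rewrite ltr_pdivrMr// mul1r; exact: ballD.
Qed.
End Radial.

(** * Lower bound for the symbol of the nonlocal Laplacian *)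

Section Lambda.
Context (R : realType) (d : nat).
Notation T := (measurableTypeR R).
Notation space := (d.-tuple T).
Notation freq := 'cV[int]_d.
Notation mu := (@lebesgue_tuple R d).

Definition unit_density := @density R d `]0, 1[.

Lemma measurable_unit_density (k : R -> R) n (delta : R) :
  nonlocal_kernel k -> measurable_fun [set: space] (unit_density k n delta).
Proof.
move=> kk; apply: measurable_density => // r.
by rewrite !in_itv/= andbT => /andP[].
Qed.

Lemma unit_density_ge0 (k : R -> R) n (delta : R) s :
  nonlocal_kernel k -> 0 < delta -> 0 <= unit_density k n delta s.
Proof.
move=> kk d0; apply: density_ge0 => // r.
by rewrite !in_itv/= andbT => /andP[].
Qed.

Lemma unit_density_out (k : R -> R) n (delta : R) s :
  0 < delta -> delta <= enorm s -> unit_density k n delta s = 0.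
Proof.
move=> d0 ds; rewrite /unit_density /density /cutoff ifF ?mulr0//.
by apply/negbTE; rewrite in_itv/= negb_and -!leNgt ler_pdivlMr// mul1r ds orbT.
Qed.

Lemma measurable_ball (delta : R) :
  measurable [set s : space | enorm s <= delta].
Proof.
rewrite -[X in measurable X]setTI.
rewrite (_ : [set s | _] = @enorm R d @^-1` `]-oo, delta]%classic); last first.
  by apply/seteqP; split => s /=; rewrite in_itv.
by apply: (@measurable_enorm R d).
Qed.

Lemma phase_eq0 (xi : freq) (s : space) : enorm s = 0 -> phase xi s = 0.
Proof.
move=> s0; apply/eqP; rewrite -normr_eq0 eq_le normr_ge0 andbT.
by apply: (le_trans (phase_le xi s)); rewrite s0 mulr0.
Qed.

Hypothesis d_gt0 : (0 < d)%N.
Variable w : R -> R.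
Hypothesis ww : nonlocal_kernel w.
Hypothesis wK1 : forall delta, 0 < delta ->
    ((2^-1)%:E * \int[mu]_x (omega_scaled d w delta (enorm x) * enorm x ^+ 2)%:E
     = d%:R%:E)%E.

Lemma second_moment delta : 0 < delta ->
  (\int[mu]_s (unit_density w (d + 2) delta s * enorm s ^+ 2)%:E = (2 * d%:R)%:E)%E.
Proof.
move=> d0; rewrite -(@integral_kernel _ _ setT)//.
- have := wK1 d0; rewrite /omega_scaled.
  set X := (\int[_]_ _ _)%E; case: X => [r| |].
  + by rewrite -EFinM => -[<-]; congr EFin; field.
  + by rewrite gt0_muley ?lte_fin ?invr_gt0.
  + by rewrite gt0_muleNy ?lte_fin ?invr_gt0.
- by apply: measurable_funX; exact: measurable_enorm.
- by move=> s ->; rewrite expr0n.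
Qed.

Lemma measurable_onem_cos_phase (xi : freq) :
  measurable_fun [set: space] (fun s => 1 - cos (phase xi s)).
Proof. apply: measurable_funB => //; exact: measurable_cos_phase. Qed.

Lemma onem_cos_phase_le (xi : freq) (s : space) :
  1 - cos (phase xi s) <= fnorm R xi ^+ 2 / 2 * enorm s ^+ 2.
Proof.
apply: (le_trans (onem_cos_ler _)); rewrite [leRHS]mulrAC ler_pM2r// -exprMn.
rewrite -real_normK ?num_real//; apply: lerXn2r; rewrite ?nnegrE//.
  by rewrite mulr_ge0// sqrtr_ge0.
exact: phase_le.
Qed.

Lemma lambda_integral delta (xi : freq) : 0 < delta ->
  ((lambda_delta w delta xi)%:E =
   \int[mu]_s (unit_density w (d + 2) delta s * (1 - cos (phase xi s)))%:E)%E.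
Proof.
move=> d0; rewrite /lambda_delta /Rintegral /omega_scaled integral_kernel//; first last.
- by move=> s /= /ltW.
- exact: measurable_ball.
- by move=> s /phase_eq0 ->; rewrite cos0 subrr.
- exact: measurable_onem_cos_phase.
have W0 s : 0 <= unit_density w (d + 2) delta s by exact: unit_density_ge0.
have mW := measurable_unit_density (d + 2) delta ww.
have me2 : measurable_fun [set: space] (fun s => enorm s ^+ 2).
  by apply: measurable_funX; exact: measurable_enorm.
rewrite fineK// ge0_fin_numE; last first.
  by apply: integral_ge0 => s _; rewrite lee_fin mulr_ge0// subr_ge0 cos_le1.
apply: (@le_lt_trans _ _ (\int[mu]_s
    (fnorm R xi ^+ 2 / 2 * (unit_density w (d + 2) delta s * enorm s ^+ 2))%:E)%E).
  apply: ge0_le_integral_EFin.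
  - by apply: measurable_funM => //; exact: measurable_onem_cos_phase.
  - by do 2 apply: measurable_funM => //.
  - by move=> s; rewrite mulr_ge0// subr_ge0 cos_le1.
  - by move=> s; rewrite mulrCA; apply: ler_wpM2l => //; exact: onem_cos_phase_le.
rewrite ge0_integral_EFinZ ?second_moment -?EFinM ?ltry//.
- by rewrite divr_ge0// exprn_ge0// fnorm_ge0.
- exact: measurable_funM.
- by move=> s; rewrite mulr_ge0// exprn_ge0// enorm_ge0.
Qed.

(** The density of the Laplacian kernel, truncated at height 1, is a weight V
    to which [weight_oscillation] applies; its integral v is positive, since
    otherwise the second moment of the kernel would vanish.  With
    [|cube| / N <= v / 2] one gets [v / 2 <= N^2 lambda]. *)
Lemma lambda_lower_bound delta : 0 < delta ->
  exists2 c, 0 < c & forall xi : freq, xi != 0 -> c <= lambda_delta w delta xi.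
Proof.
move=> d0.
have W0 s : 0 <= unit_density w (d + 2) delta s by exact: unit_density_ge0.
have mW := measurable_unit_density (d + 2) delta ww.
pose V (s : space) := Num.min (unit_density w (d + 2) delta s) 1.
have mV : measurable_fun [set: space] V by exact: measurable_minr.
have V0 s : 0 <= V s by rewrite le_min W0 ler01.
(* a half-side of the cube that is at least delta and a multiple of pi *)
pose M := (Num.truncn delta).+1.
pose L : R := M%:R * pi.
have dL : delta <= L.
  rewrite /L (le_trans (ltW (truncnS_gt delta)))// ler_peMr ?ler0n//.
  by rewrite (le_trans _ (pi_ge2 R))// ler1n.
have L0 : 0 < L by rewrite (lt_le_trans d0).
have sL (k : int) : sin (k%:~R * L) = 0.
  by rewrite /L mulrA -[M%:R]/(M%:Z%:~R) -intrM sin_int_pi.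
have VQ s : 0 <= V s <= \1_(box (fun=> `[- L, L]%classic)) s.
  rewrite V0/= indicE; have [sd|sd] := leP delta (enorm s).
    by rewrite /V unit_density_out// min_l ?ler01.
  rewrite mem_set ?ge_min ?lexx ?orbT// => i /=.
  by rewrite in_itv/= -ler_norml (le_trans (coord_le _ _))// (le_trans (ltW sd)).
have mQ : measurable (box (fun=> `[- L, L]%classic) : set space).
  by apply: measurable_box => i; exact: measurable_itv.
have me2 : measurable_fun [set: space] (fun s => enorm s ^+ 2).
  by apply: measurable_funX; exact: measurable_enorm.
have : (0 < \int[mu]_s (V s)%:E)%E.
  rewrite lt0e integral_ge0 ?andbT; last by move=> s _; rewrite lee_fin.
  apply/eqP => iV.
  have /(ae_eq_integral_abs mu measurableT) : measurable_fun setT (EFin \o V).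
    exact/measurable_EFinP.
  rewrite (eq_integral (fun s => (V s)%:E)); last first.
    by move=> s _ /=; rewrite ger0_norm.
  rewrite iV => -[/(_ erefl) V00 _].
  have := second_moment d0; rewrite (_ : (\int[_]_ _ _)%E = 0%E).
    by move=> [] /eqP; rewrite eq_sym mulf_eq0 !pnatr_eq0/= -leqn0 leqNgt d_gt0.
  rewrite (ge0_ae_eq_integral (g := cst 0%E))//.
  - by rewrite integral0.
  - by apply/measurable_EFinP; exact: measurable_funM.
  - by move=> s _; rewrite lee_fin mulr_ge0// exprn_ge0// enorm_ge0.
  move: V00; apply: filterS => s /= /(_ Logic.I) [] V0s _; congr EFin.
  suff -> : unit_density w (d + 2) delta s = 0 by rewrite mul0r.
  apply/eqP; rewrite eq_le W0 andbT; move: V0s; rewrite /V.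
  by case: (leP (unit_density w (d + 2) delta s) 1) => [_ ->|_ /eqP]; rewrite ?lexx ?oner_eq0.
have : (\int[mu]_s (V s)%:E < +oo)%E.
  apply: (@le_lt_trans _ _ (mu (box (fun=> `[- L, L]%classic) : set space))).
    rewrite -[X in mu X]setIT -integral_indic//.
    apply: ge0_le_integral_EFin; [exact: mV|exact: measurable_indic|exact: V0|].
    by move=> s; have /andP[] := VQ s.
  rewrite (@measure_box _ _ _ (fun=> 2 * L)) ?ltry// => i.
  by rewrite lebesgue_measure_itv/= lte_fin gtrN// -EFinB; congr EFin; ring.
have := fun x N N0 i => @weight_oscillation R d V x L N L0 sL N0 i mV VQ.
case: (\int[mu]_s (V s)%:E)%E => [v|//|//] osc _; rewrite lte_fin => v0.
set q := (2 * L) ^+ d in osc.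
(* so that q / N <= v / 2, with q the volume of the cube *)
pose N := (Num.truncn (2 * q / v)).+1.
have N0 : 0 < N%:R :> R by rewrite ltr0n.
exists (v / (2 * N%:R ^+ 2)); first by rewrite divr_gt0// mulr_gt0// exprn_gt0.
move=> xi /freq_neq0 xi0; have {osc} := osc (fun i => xi i 0) N isT xi0 => osc.
have qN : q / N%:R <= v / 2.
  rewrite ler_pdivrMr// mulrAC ler_pdivlMr// mulrC -ler_pdivrMl// mulrC.
  have -> : v^-1 * (q * 2) = 2 * q / v by ring.
  by rewrite ltW// truncnS_gt.
have : (v%:E <= (v / 2)%:E + (N%:R ^+ 2)%:E * (lambda_delta w delta xi)%:E)%E.
  apply: (le_trans osc); apply: leeD; first by rewrite lee_fin.
  apply: lee_wpmul2l; first by rewrite lee_fin exprn_ge0.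
  rewrite lambda_integral//; apply: ge0_le_integral_EFin.
  - by apply: measurable_funM => //; exact: measurable_onem_cos_phase.
  - by apply: measurable_funM => //; exact: measurable_onem_cos_phase.
  - by move=> s; rewrite mulr_ge0// subr_ge0 cos_le1.
  - by move=> s; rewrite ler_wpM2r ?subr_ge0 ?cos_le1// /V ge_min lexx.
rewrite -EFinM -EFinD lee_fin => h.
rewrite ler_pdivrMr ?mulr_gt0 ?exprn_gt0//; lra.
Qed.

End Lambda.

(** * Lower bound for the symbol of the nonlocal gradient *)

Section Drift.
Context (R : realType) (d : nat).
Notation T := (measurableTypeR R).
Notation space := (d.-tuple T).
Notation freq := 'cV[int]_d.
Notation mu := (@lebesgue_tuple R d).

(** From [t^a = exp (a ln t) >= 1 + a ln t] and [ln t >= 1 - 1 / t]. *)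
Lemma powR_sub1_ge (t a : R) : 1 < t -> 0 <= a -> a * (t - 1) / t <= t `^ a - 1.
Proof.
move=> t1 a0; have t0 : 0 < t by rewrite (lt_trans _ t1).
have lnt : 1 - t^-1 <= ln t.
  have := @le_ln1Dx R (t^-1 - 1).
  have -> : 1 + (t^-1 - 1) = t^-1 by ring.
  rewrite lnV ?posrE// => h.
  suff : - ln t <= t^-1 - 1 by lra.
  by apply: h; rewrite ltrBrDl subrr invr_gt0.
rewrite /powR gt_eqF//; apply: (@le_trans _ _ (a * ln t)).
  rewrite -mulrA; apply: ler_wpM2l => //.
  by rewrite mulrBl mul1r divff ?gt_eqF.
by have := expR_ge1Dx (a * ln t); lra.
Qed.

Hypothesis d_gt0 : (0 < d)%N.
Variables (hw : R -> R) (delta : R) (xi : freq).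
Hypothesis hker : nonlocal_kernel hw.
Hypothesis d0 : 0 < delta.
Hypothesis hK2 :
  (\int[mu]_x (omegahat_scaled d hw delta (enorm x) * enorm x)%:E = d%:R%:E)%E.

Let H : space -> R := unit_density hw (d + 1) delta.
Let X : space -> R := phase xi.

Let H_ge0 s : 0 <= H s. Proof. exact: unit_density_ge0. Qed.
Let mH : measurable_fun [set: space] H. Proof. exact: measurable_unit_density. Qed.
Let mX : measurable_fun [set: space] X. Proof. exact: measurable_phase. Qed.
Let me : measurable_fun [set: space] (@enorm R d). Proof. exact: measurable_enorm. Qed.

Let mHe : measurable_fun [set: space] (fun s => H s * enorm s).
Proof. exact: measurable_funM. Qed.

Let mV : measurable_fun [set: space] (fun s => (enorm s)^-1).
Proof.
rewrite (_ : (fun s => _) = (fun s => enorm s `^ (-1))).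
  exact: (measurableT_comp (measurable_powR (-1)) me).
by apply/funext => s; rewrite powR_inv1// enorm_ge0.
Qed.

Lemma first_moment : (\int[mu]_s (H s * enorm s)%:E = d%:R%:E)%E.
Proof. by rewrite -(@integral_kernel _ _ setT). Qed.

(** The gradient kernel itself need not be integrable, only its first moment
    is; the trigonometric factors provide the missing power of |s|. *)
Lemma dominated_integrable (f : space -> R) (C : R) :
  measurable_fun [set: space] f -> (forall s, `|f s| <= C * (H s * enorm s)) ->
  mu.-integrable setT (EFin \o f).
Proof.
move=> mf fC.
have iH : mu.-integrable setT (EFin \o (fun s => H s * enorm s)).
  apply: ge0_integrable_EFin => //; first by move=> s; rewrite mulr_ge0// enorm_ge0.
  by rewrite first_moment ltry.
have iCH := integrableZl measurableT C iH.
apply: (le_integrable _ _ _ iCH) => //; first exact/measurable_EFinP.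
move=> s _ /=; rewrite lee_fin (le_trans (fC s))//.
exact: ler_norm.
Qed.

Let mS : measurable_fun [set: space] (fun s => sin (X s)).
Proof.
exact: (measurableT_comp (continuous_measurable_fun (@continuous_sin R)) mX).
Qed.

Let measurable_direction i :
  measurable_fun [set: space] (fun s => tnth s i / enorm s).
Proof. by apply: measurable_funM => //; exact: measurable_tnth. Qed.

Lemma b_delta_integral i : b_delta hw delta xi i 0 =
  \int[mu]_s (H s * (tnth s i / enorm s * sin (X s))).
Proof.
rewrite mxE /Rintegral; congr fine.
rewrite -(@integral_kernel _ _ [set s | enorm s <= delta])//.
- by apply: eq_integral => s _; rewrite /omegahat_scaled; congr EFin; ring.
- by apply: measurable_funM; [exact: measurable_direction|exact: mS].
- by move=> s /phase_eq0; rewrite /X => ->; rewrite sin0 mulr0.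
- exact: measurable_ball.
- by move=> s /= /ltW.
Qed.

Lemma b_delta_integrable i :
  mu.-integrable setT (EFin \o (fun s => H s * (tnth s i / enorm s * sin (X s)))).
Proof.
apply: (@dominated_integrable _ (fnorm R xi)).
  by apply: measurable_funM => //; exact: measurable_funM.
move=> s; rewrite normrM (ger0_norm (H_ge0 s)) (mulrCA (fnorm _ _)); apply: ler_wpM2l => //.
rewrite normrM -[leRHS]mul1r; apply: ler_pM => //.
  rewrite normrM normfV (ger0_norm (enorm_ge0 s)).
  have [->|e0] := eqVneq (enorm s) 0; first by rewrite invr0 mulr0 ler01.
  by rewrite ler_pdivrMr ?mul1r ?coord_le// lt_def e0 enorm_ge0.
exact: (le_trans (normr_sin_le _) (phase_le _ _)).
Qed.

Lemma b_delta_dot : \sum_(i < d) (xi i 0)%:~R * b_delta hw delta xi i 0 =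
  \int[mu]_s (H s / enorm s * (X s * sin (X s))).
Proof.
transitivity (\int[mu]_s (\sum_(i < d) (xi i 0)%:~R *
    (H s * (tnth s i / enorm s * sin (X s)))))%R; last first.
  apply: eq_Rintegral => s _; rewrite {2}/X /phase mulr_suml mulr_sumr.
  by apply: eq_bigr => i _; ring.
rewrite Rintegral_sum; last first.
  by move=> i; apply: integrable_EFinZ; exact: b_delta_integrable.
apply: eq_bigr => i _; rewrite b_delta_integral RintegralZl//.
exact: b_delta_integrable.
Qed.

(** The quotient is the weight that goes with [xi . s]; at the origin it is 0,
    by the convention on division. *)
Let K (s : space) : R := H s / enorm s.

Let K0 s : 0 <= K s. Proof. by rewrite divr_ge0// enorm_ge0. Qed.

Let mK : measurable_fun [set: space] K. Proof. exact: measurable_funM. Qed.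

Lemma kernel_phase_sqr_le s : K s * X s ^+ 2 <= fnorm R xi ^+ 2 * (H s * enorm s).
Proof.
have [e0|e0] := eqVneq (enorm s) 0.
  by rewrite /X (phase_eq0 xi e0) e0 expr0n !mulr0.
have -> : H s * enorm s = K s * enorm s ^+ 2 by rewrite /K; field.
rewrite [leRHS]mulrCA; apply: ler_wpM2l => //; rewrite -exprMn -real_normK ?num_real//.
by apply: lerXn2r; rewrite ?nnegrE ?mulr_ge0 ?fnorm_ge0 ?enorm_ge0//; exact: phase_le.
Qed.

Lemma kernel_integrable (g : space -> R) (C : R) : 0 <= C ->
  measurable_fun [set: space] g -> (forall s, `|g s| <= C * X s ^+ 2) ->
  mu.-integrable setT (EFin \o (fun s => K s * g s)).
Proof.
move=> C0 mg gC; apply: (@dominated_integrable _ (C * fnorm R xi ^+ 2)).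
  exact: measurable_funM.
move=> s; rewrite normrM (ger0_norm (K0 s)).
rewrite (le_trans (ler_wpM2l (K0 s) (gC s)))// mulrCA -mulrA.
by apply: ler_wpM2l => //; exact: kernel_phase_sqr_le.
Qed.

Let m1cos (u : R) : measurable_fun [set: space] (fun s => 1 - cos (u * X s)).
Proof.
apply: measurable_funB => //.
apply: (measurableT_comp (continuous_measurable_fun (@continuous_cos R))).
exact: measurable_funM.
Qed.

Lemma kernel_cos_integrable (u : R) :
  mu.-integrable setT (EFin \o (fun s => K s * (1 - cos (u * X s)))).
Proof.
apply: (@kernel_integrable _ (u ^+ 2 / 2)) => //; first by rewrite divr_ge0// sqr_ge0.
move=> s; rewrite ger0_norm ?subr_ge0 ?cos_le1//.
by apply: (le_trans (onem_cos_ler _)); rewrite exprMn; lra.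
Qed.

(** Expansion of [L(t) = int K(s) (1 - cos (t xi . s)) ds] at t = 1, with the
    remainder [(t - 1)^2 int K(s) (xi . s)^2 ds], which the first moment of the
    kernel controls. *)
Lemma expansion_upper t : 1 < t ->
  \int[mu]_s (K s * (1 - cos (t * X s))) <=
  \int[mu]_s (K s * (1 - cos (X s)))
  + (t - 1) * (\int[mu]_s (K s * (X s * sin (X s))))
  + (t - 1) ^+ 2 * (fnorm R xi ^+ 2 * d%:R).
Proof.
move=> t1.
have is_ : mu.-integrable setT (EFin \o (fun s => K s * (X s * sin (X s)))).
  apply: (@kernel_integrable _ 1) => //; first exact: measurable_funM.
  move=> s; rewrite normrM mul1r -real_normK ?num_real// expr2.
  by apply: ler_wpM2l => //; exact: normr_sin_le.
have i2 : mu.-integrable setT (EFin \o (fun s => K s * X s ^+ 2)).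
  apply: (@kernel_integrable _ 1) => //; first exact: measurable_funX.
  by move=> s; rewrite mul1r ger0_norm ?sqr_ge0.
have i1 : mu.-integrable setT (EFin \o (fun s => K s * (1 - cos (X s)))).
  by have := kernel_cos_integrable 1; under eq_fun do rewrite mul1r.
apply: (@le_trans _ _ (\int[mu]_s (K s * (1 - cos (X s))
    + (t - 1) * (K s * (X s * sin (X s))) + (t - 1) ^+ 2 * (K s * X s ^+ 2)))).
  apply: le_Rintegral => //; first exact: kernel_cos_integrable.
    apply: integrable_EFinD; last exact: integrable_EFinZ.
    by apply: integrable_EFinD => //; exact: integrable_EFinZ.
  move=> s _; have := cos_taylor (X s) ((t - 1) * X s).
  have -> : X s + (t - 1) * X s = t * X s by ring.
  move=> h; have : 1 - cos (t * X s) <= 1 - cos (X s)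
      + (t - 1) * (X s * sin (X s)) + (t - 1) ^+ 2 * X s ^+ 2 by lra.
  by move=> /(ler_wpM2l (K0 s)) /le_trans; apply; rewrite le_eqVlt; apply/orP; left;
    apply/eqP; ring.
rewrite RintegralD//; last 2 first.
- by apply: integrable_EFinD => //; exact: integrable_EFinZ.
- exact: integrable_EFinZ.
rewrite RintegralD//; last exact: integrable_EFinZ.
rewrite !RintegralZl// lerD2l; apply: ler_wpM2l; first exact: sqr_ge0.
apply: (@le_trans _ _ (\int[mu]_s (fnorm R xi ^+ 2 * (H s * enorm s)))).
  apply: le_Rintegral => //; last by move=> s _; exact: kernel_phase_sqr_le.
  apply: (@dominated_integrable _ (fnorm R xi ^+ 2)); first exact: measurable_funM.
  move=> s; rewrite ger0_norm; first exact: lexx.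
  exact: mulr_ge0 (sqr_ge0 _) (mulr_ge0 (H_ge0 s) (enorm_ge0 s)).
rewrite RintegralZl//; last first.
  apply: (@dominated_integrable _ 1) => // s.
  by rewrite mul1r ger0_norm// mulr_ge0// enorm_ge0.
by rewrite /Rintegral first_moment.
Qed.

(** Change of variable [s -> s / t], which moves the parameter t from the
    oscillating factor to the kernel. *)
Lemma scaled_integral t : 0 < t ->
  (\int[mu]_s (K s * (1 - cos (t * X s)))%:E =
   \int[mu]_s (t ^- d * K (map_tuple ( *%R t^-1) s) * (1 - cos (X s)))%:E)%E.
Proof.
move=> t0; rewrite (@integral_tuple_scale R d t (fun s => (t ^- d *
  K (map_tuple ( *%R t^-1) s) * (1 - cos (X s)))%:E))//; last 2 first.
- apply/measurable_EFinP; apply: measurable_funM; last first.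
    exact: measurable_onem_cos_phase.
  apply: measurable_funM => //.
  exact: (measurableT_comp mK (@measurable_scale_tuple R d t^-1)).
- move=> s; rewrite lee_fin; apply: mulr_ge0; last by rewrite subr_ge0 cos_le1.
  by apply: mulr_ge0; [rewrite invr_ge0 exprn_ge0// ltW|exact: K0].
have E (s : space) : map_tuple ( *%R t^-1) (map_tuple ( *%R t) s) = s.
  by apply: eq_from_tnth => i; rewrite !tnth_map mulKf// gt_eqF.
under [in RHS]eq_integral do rewrite E /X phase_scale -mulrA EFinM.
rewrite ge0_integralZl//; last 3 first.
- by apply/measurable_EFinP; exact: measurable_funM.
- by move=> s _; rewrite lee_fin; apply: mulr_ge0; rewrite ?K0// subr_ge0 cos_le1.
- by rewrite lee_fin invr_ge0 exprn_ge0// ltW.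
by rewrite muleA -EFinM mulfV ?mul1e// expf_neq0// gt_eqF.
Qed.

Lemma kernel_inside s : 0 < enorm s < delta ->
  K s = delta ^- (d + 1) * hw (enorm s / delta) / enorm s.
Proof.
move=> /andP[s0 sd]; rewrite /K /H /unit_density /density /cutoff in_itv/=.
by rewrite divr_gt0//= ltr_pdivrMr// mul1r sd.
Qed.

Lemma kernel_outside s : delta <= enorm s -> K s = 0.
Proof. by move=> ds; rewrite /K /H unit_density_out// mul0r. Qed.

Hypothesis hK3 : forall r s, 0 < r -> r <= s -> s < 1 ->
    s ^+ d.-1 * hw s <= r ^+ d.-1 * hw r.

(** Inside the ball, up to the factor [delta^-2 |s|^-d], both sides are values
    of [r^(d-1) hw(r)], at the radii [|s| / delta] and [|s| / (t delta)]. *)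
Lemma kernel_scale_mono t s : 1 < t ->
  K s <= t ^- d * K (map_tuple ( *%R t^-1) s).
Proof.
move=> t1; have t0 : 0 < t by rewrite (lt_trans _ t1).
have RHS0 : 0 <= t ^- d * K (map_tuple ( *%R t^-1) s).
  by apply: mulr_ge0; [rewrite invr_ge0 exprn_ge0// ltW|exact: K0].
have [s0|s0] := eqVneq (enorm s) 0; first by rewrite {1}/K s0 invr0 mulr0.
have {}s0 : 0 < enorm s by rewrite lt_def s0 enorm_ge0.
have [ds|ds] := leP delta (enorm s); first by rewrite kernel_outside.
have et : enorm (map_tuple ( *%R t^-1) s : space) = t^-1 * enorm s.
  by rewrite enorm_scale// invr_ge0 ltW.
have ts : t^-1 * enorm s < enorm s by rewrite gtr_pMl// invf_lt1.
rewrite kernel_inside ?s0// kernel_inside; last first.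
  by rewrite et mulr_gt0 ?invr_gt0//= (lt_trans ts).
rewrite et; set x := enorm s / delta.
have x0 : 0 < x by rewrite divr_gt0.
have x1 : x < 1 by rewrite ltr_pdivrMr// mul1r.
have -> : t^-1 * enorm s / delta = t^-1 * x by rewrite /x mulrA.
have := @hK3 (t^-1 * x) x; rewrite mulr_gt0 ?invr_gt0// => /(_ isT).
have tx : t^-1 * x <= x by rewrite ger_pMl// invf_le1// ltW.
move=> /(_ tx x1); rewrite (exprMn _ t^-1 x).
have -> : t^-1 ^+ d.-1 * x ^+ d.-1 * hw (t^-1 * x) =
  x ^+ d.-1 * (t^-1 ^+ d.-1 * hw (t^-1 * x)) by ring.
rewrite ler_pM2l ?exprn_gt0// => h.
have -> : t ^- d * (delta ^- (d + 1) * hw (t^-1 * x) / (t^-1 * enorm s)) =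
    delta ^- (d + 1) * (t^-1 ^+ d.-1 * hw (t^-1 * x)) / enorm s.
  rewrite -[in t ^- d](prednK d_gt0) exprSr exprVn.
  by field; rewrite !gt_eqF ?exprn_gt0.
rewrite ler_pM2r ?invr_gt0// ler_pM2l// invr_gt0 exprn_gt0//.
Qed.

Variables (eps c beta : R).
Hypothesis beta1 : -1 < beta < 1.
Hypothesis c0 : 0 < c.
Hypothesis hK4 : forall r, 0 < r < eps -> hw r = c * r `^ (- d%:R - beta).

(** Near the origin the kernel is homogeneous, and the increment is equal to
    [c delta^-(d+2) x^(-d-beta) / x (t^(1+beta) - 1)] with
    [x = |s| / delta <= y]; the exponent [- d - beta] is negative. *)
Lemma kernel_scale_surplus t s y : 1 < t -> 0 < enorm s -> enorm s <= y * delta ->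
  y < 1 -> y < eps ->
  c * delta ^- (d + 2) * y `^ (- d%:R - beta) / y * (t `^ (1 + beta) - 1) <=
  t ^- d * K (map_tuple ( *%R t^-1) s) - K s.
Proof.
move=> t1 s0 sy y1 ye; have t0 : 0 < t by rewrite (lt_trans _ t1).
have et : enorm (map_tuple ( *%R t^-1) s : space) = t^-1 * enorm s.
  by rewrite enorm_scale// invr_ge0 ltW.
have sd : enorm s < delta.
  by apply: (le_lt_trans sy); rewrite gtr_pMl.
have ts : t^-1 * enorm s < enorm s by rewrite gtr_pMl// invf_lt1.
rewrite (@kernel_inside s) ?s0// kernel_inside; last first.
  by rewrite et mulr_gt0 ?invr_gt0//= (lt_trans ts).
rewrite et; set x := enorm s / delta.
have x0 : 0 < x by rewrite divr_gt0.
have xy : x <= y by rewrite ler_pdivrMr.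
have -> : t^-1 * enorm s / delta = t^-1 * x by rewrite /x mulrA.
have txx : t^-1 * x < x by rewrite gtr_pMl// invf_lt1.
have y0 : 0 < y by exact: lt_le_trans xy.
rewrite !hK4; last 2 first.
- by rewrite x0 (le_lt_trans xy).
- by rewrite mulr_gt0 ?invr_gt0//= (lt_trans txx)// (le_lt_trans xy).
set e := - d%:R - beta.
have e0 : e <= 0.
  have : 1 <= d%:R :> R by rewrite ler1n.
  by have /andP[] := beta1; rewrite /e; lra.
have -> : (t^-1 * x) `^ e = t ^+ d * t `^ beta * x `^ e.
  rewrite powRM ?invr_ge0 ?ltW// -(powR_inv1 (ltW t0)) -powRrM; congr (_ * _).
  rewrite (_ : -1 * e = d%:R + beta); last by rewrite /e; ring.
  by rewrite powRD ?powR_mulrn ?ltW// (gt_eqF t0) implybT.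
have -> : t `^ (1 + beta) = t * t `^ beta.
  by rewrite powRD ?powRr1 ?ltW// (gt_eqF t0) implybT.
have -> : t ^- d * (delta ^- (d + 1) * (c * (t ^+ d * t `^ beta * x `^ e)) /
    (t^-1 * enorm s)) - delta ^- (d + 1) * (c * x `^ e) / enorm s =
    c * delta ^- (d + 2) * (x `^ e / x) * (t * t `^ beta - 1).
  have -> : delta ^+ (d + 2) = delta ^+ (d + 1) * delta by rewrite -exprSr addn2 addn1.
  rewrite /x; field.
  by rewrite !gt_eqF ?exprn_gt0.
have tb : 0 <= t * t `^ beta - 1.
  rewrite -{1}(powRr1 (ltW t0)) -powRD ?(gt_eqF t0) ?implybT//.
  rewrite subr_ge0 -[leLHS](powRr0 t) ler_powR ?ltW//.
  by have /andP[] := beta1; lra.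
rewrite ler_wpM2r// -[leLHS]mulrA ler_wpM2l//.
  by rewrite mulr_ge0 ?invr_ge0 ?exprn_ge0// ltW.
apply: ler_pM; rewrite ?powR_ge0 ?invr_ge0 ?(ltW y0)//.
  rewrite -(opprK e) !(powRN _ (- e)) lef_pV2 ?posrE ?powR_gt0//.
  by apply: ge0_ler_powR; rewrite ?nnegrE ?oppr_ge0 ?(ltW x0) ?(ltW y0).
by rewrite lef_pV2 ?posrE.
Qed.

(** The signs of the sides follow those of the coordinates of xi, so that no
    cancellation occurs in [xi . s] when s is in the box. *)
Definition signed_box (a : R) : 'I_d -> set T := fun i =>
  if 0 <= xi i 0 then `[a, 2 * a]%classic else `[- (2 * a), - a]%classic.

Lemma signed_box_coord (a : R) s i : 0 < a -> box (signed_box a) s ->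
  a * `|(xi i 0)%:~R| <= (xi i 0)%:~R * tnth s i /\ `|tnth s i| <= 2 * a.
Proof.
move=> a0 /(_ i); rewrite /signed_box; case: leP => x0 /=;
  rewrite in_itv/= => /andP[sa sb].
- have x0' : 0 <= (xi i 0)%:~R :> R by rewrite ler0z.
  by rewrite ger0_norm// mulrC ler_wpM2l// ger0_norm// (le_trans (ltW a0)).
- have x0' : (xi i 0)%:~R <= 0 :> R by rewrite lerz0 ltW.
  split; first by rewrite ler0_norm//; nra.
  by rewrite ler0_norm; lra.
Qed.

Lemma signed_box_measure (a : R) : 0 < a ->
  mu (box (signed_box a)) = (a ^+ d)%:E.
Proof.
move=> a0; rewrite (@measure_box _ _ _ (fun=> a)).
- by rewrite prodr_const card_ord.
- by move=> i; rewrite /signed_box; case: ifP.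
- move=> i; rewrite /signed_box; case: ifP => _;
  rewrite lebesgue_measure_itv/= lte_fin.
  + by rewrite ltr_pMl ?ltr1n// -EFinB; congr EFin; ring.
  + by rewrite ltrN2 ltr_pMl ?ltr1n// -EFinB; congr EFin; ring.
Qed.

Lemma measurable_signed_box (a : R) : measurable (box (signed_box a)).
Proof. by apply: measurable_box => i; rewrite /signed_box; case: ifP. Qed.

Let kappa : R := c / (4 * (2 * d%:R) ^+ (d + 2)).

(** The surplus of [kernel_scale_surplus] is integrated over the signed box
    with [a = y delta / (2 d)]: there [|s| <= y delta], and
    [a |xi| <= xi . s <= 1], so that [1 - cos (xi . s) >= a^2 |xi|^2 / 4].  The
    powers of delta cancel out. *)
Lemma surplus_lower t y : 1 < t -> 0 < y -> y < 1 -> y < eps ->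
  y * delta * fnorm R xi <= 1 ->
  kappa * y `^ (1 - beta) * fnorm R xi ^+ 2 * (t `^ (1 + beta) - 1)
  + \int[mu]_s (K s * (1 - cos (X s))) <= \int[mu]_s (K s * (1 - cos (t * X s))).
Proof.
move=> t1 y0 y1 ye yx.
have t0 : 0 < t by rewrite (lt_trans _ t1).
have dR : 0 < d%:R :> R by rewrite ltr0n.
set a := y * delta / (2 * d%:R).
have a0 : 0 < a by rewrite !(divr_gt0, mulr_gt0).
have mB := measurable_signed_box a.
set k1 := c * delta ^- (d + 2) * y `^ (- d%:R - beta) / y * (t `^ (1 + beta) - 1).
have tb : 0 <= t `^ (1 + beta) - 1.
  rewrite subr_ge0 -[leLHS](powRr0 t) ler_powR ?ltW//.
  by have /andP[] := beta1; lra.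
have k10 : 0 <= k1.
  by rewrite !(divr_ge0, mulr_ge0)// ?invr_ge0 ?exprn_ge0 ?powR_ge0 ?ltW.
set k2 := a ^+ 2 * fnorm R xi ^+ 2 / 4.
have k20 : 0 <= k2 by rewrite divr_ge0// mulr_ge0// sqr_ge0.
have E : kappa * y `^ (1 - beta) * fnorm R xi ^+ 2 * (t `^ (1 + beta) - 1)
    = k1 * k2 * a ^+ d.
  have -> : y `^ (1 - beta) = y `^ (- d%:R - beta) * y ^+ (d + 1).
    rewrite -powR_mulrn ?(ltW y0)// -powRD ?(gt_eqF y0) ?implybT//.
    by congr (_ `^ _); rewrite natrD; ring.
  rewrite /k1 /k2 /kappa /a.
  rewrite (_ : delta ^+ (d + 2) = delta ^+ d * delta ^+ 2) ?exprD//.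
  rewrite !expr_div_n !exprMn expr1; field.
  by rewrite ?(gt_eqF, exprn_gt0, mulr_gt0)//.
have i1 := kernel_cos_integrable 1.
have mf1 : measurable_fun [set: space] (fun s => K s * (1 - cos (X s))).
  by apply: measurable_funM => //; exact: measurable_onem_cos_phase.
have f10 s : 0 <= K s * (1 - cos (X s)).
  by apply: mulr_ge0; rewrite ?K0// subr_ge0 cos_le1.
have m1B : measurable_fun [set: space] (\1_(box (signed_box a)) : _ -> R).
  exact: measurable_indic.
have mB1 : measurable_fun [set: space] (fun s => k1 * k2 * \1_(box (signed_box a)) s).
  exact: measurable_funM.
have key : (\int[mu]_s (K s * (1 - cos (X s)) + k1 * k2 * \1_(box (signed_box a)) s)%:E
    <= \int[mu]_s (K s * (1 - cos (t * X s)))%:E)%E.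
  rewrite scaled_integral//; apply: ge0_le_integral_EFin.
  - exact: measurable_funD.
  - apply: measurable_funM; last exact: measurable_onem_cos_phase.
    apply: measurable_funM => //.
    exact: (measurableT_comp mK (@measurable_scale_tuple R d t^-1)).
  - by move=> s; apply: addr_ge0; [exact: f10|rewrite mulr_ge0// mulr_ge0].
  - move=> s; have cs : 0 <= 1 - cos (X s) by rewrite subr_ge0 cos_le1.
    rewrite indicE; have [/set_mem sB|_] := boolP (s \in box (signed_box a)); last first.
      by rewrite mulr0 addr0; apply: ler_wpM2r => //; exact: kernel_scale_mono.
    rewrite mulr1 -lerBrDl -mulrBl.
    have es : enorm s <= y * delta.
      apply: (le_trans (sqrt_sum_sqr_le (tnth s))).
      apply: (@le_trans _ _ (\sum_(i < d) 2 * a)).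
        by apply: ler_sum => i _; have [] := signed_box_coord i a0 sB.
      rewrite sumr_const card_ord -mulr_natr /a le_eqVlt; apply/orP; left.
      by apply/eqP; field; rewrite gt_eqF.
    have s0 : 0 < enorm s.
      pose i := Ordinal d_gt0.
      apply: (@lt_le_trans _ _ `|tnth s i|); last exact: coord_le.
      have := sB i; rewrite /signed_box normr_gt0; case: ifP => _ /=;
      rewrite in_itv/= => /andP[h1 h2].
        by rewrite gt_eqF// (lt_le_trans a0).
      by rewrite lt_eqF// (le_lt_trans h2)// oppr_lt0.
    apply: ler_pM => //; first exact: kernel_scale_surplus.
    have Xa : a * fnorm R xi <= X s.
      apply: (@le_trans _ _ (\sum_(i < d) a * `|(xi i 0)%:~R|)).
        by rewrite -mulr_sumr; apply: ler_wpM2l; [exact: ltW|exact: sqrt_sum_sqr_le].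
      by apply: ler_sum => i _; have [] := signed_box_coord i a0 sB.
    have X1 : `|X s| <= 1.
      apply: (le_trans (phase_le xi s)); rewrite mulrC (le_trans _ yx)//.
      by apply: ler_wpM2r => //; exact: fnorm_ge0.
    apply: (le_trans _ (onem_cos_ger X1)); rewrite /k2 ler_pM2r// -exprMn.
    have af0 : 0 <= a * fnorm R xi by rewrite mulr_ge0 ?fnorm_ge0 ?ltW.
    by apply: lerXn2r => //; rewrite nnegrE// (le_trans af0).
have it := kernel_cos_integrable t.
have i1' : mu.-integrable setT (EFin \o (fun s => K s * (1 - cos (X s)))).
  by move: i1; under eq_fun do rewrite mul1r.
move: key; rewrite ge0_integral_EFinD//; last by move=> s; rewrite mulr_ge0// mulr_ge0.
rewrite ge0_integral_EFinZ//; last exact: mulr_ge0.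
have -> : (\int[mu]_s (\1_(box (signed_box a)) s)%:E = (a ^+ d)%:E)%E.
  by rewrite integral_indic// setIT; exact: signed_box_measure.
rewrite -EFinM.
rewrite -(fineK (integrable_fin_num measurableT i1')).
rewrite -(fineK (integrable_fin_num measurableT it)) -EFinD lee_fin E.
by rewrite addrC.
Qed.

(** Comparing [surplus_lower] with [expansion_upper] and dividing by
    [t - 1] gives the bound up to an error of order [t - 1], which is
    arbitrary. *)
Lemma drift_lower y : 0 < y -> y < 1 -> y < eps -> y * delta * fnorm R xi <= 1 ->
  kappa * y `^ (1 - beta) * (1 + beta) * fnorm R xi ^+ 2
  <= \sum_(i < d) (xi i 0)%:~R * b_delta hw delta xi i 0.
Proof.
move=> y0 y1 ye yx; rewrite b_delta_dot -/K.
set B := (\int[mu]_s _)%R.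
set A := kappa * _ * _ * _.
have /andP[bm bp] := beta1.
have dR : 0 < d%:R :> R by rewrite ltr0n.
have kappa0 : 0 < kappa.
  by rewrite divr_gt0// mulr_gt0// exprn_gt0// mulr_gt0.
set M := fnorm R xi ^+ 2 * d%:R.
have M0 : 0 <= M by rewrite mulr_ge0// ?sqr_ge0// ltW.
have kY : 0 <= kappa * y `^ (1 - beta).
  by apply: mulr_ge0; [exact: ltW|exact: powR_ge0].
have bp1 : 0 <= 1 + beta by lra.
have A0 : 0 <= A.
  by apply: mulr_ge0; [exact: mulr_ge0|exact: sqr_ge0].
rewrite leNgt; apply/negP => BA.
have AM : 0 < A + M + 1 by lra.
(* small enough for B + h M < A (1 - h) <= A / (1 + h) *)
pose h := (A - B) / (2 * (A + M + 1)).
have h0 : 0 < h by rewrite divr_gt0 ?subr_gt0// mulr_gt0.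
have t1 : 1 < 1 + h by rewrite ltrDl.
have := le_trans (surplus_lower t1 y0 y1 ye yx) (expansion_upper t1).
rewrite -/B -/M.
have -> : 1 + h - 1 = h by ring.
have := @powR_sub1_ge (1 + h) (1 + beta) t1 bp1.
have -> : 1 + h - 1 = h by ring.
set k := kappa * y `^ (1 - beta) * fnorm R xi ^+ 2.
have k0 : 0 <= k by apply: mulr_ge0 => //; exact: sqr_ge0.
move=> /(ler_wpM2l k0) le1 le2.
have {le1 le2} : k * ((1 + beta) * h / (1 + h)) <= h * B + h ^+ 2 * M by lra.
have -> : k * ((1 + beta) * h / (1 + h)) = h * (A / (1 + h)).
  by rewrite /A /k; field; lra.
have -> : h * B + h ^+ 2 * M = h * (B + h * M) by ring.
rewrite ler_pM2l//.
have : A * (1 - h) <= A / (1 + h).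
  rewrite ler_pdivlMr; last by lra.
  by nra.
have : h * (2 * (A + M + 1)) = A - B by rewrite /h divfK// gt_eqF// mulr_gt0.
nra.
Qed.

End Drift.

(** * Uniform bounds from the kernel assumptions *)

Section Assumptions.
Context (R : realType) (d : nat) (w hw : R -> R) (beta : R).
Notation freq := 'cV[int]_d.
Hypothesis d_gt0 : (0 < d)%N.
Hypothesis hK : kernel_assumptions d w hw beta.

Lemma b_deltaN delta (xi : freq) i : 0 < delta ->
  b_delta hw delta (- xi) i 0 = - b_delta hw delta xi i 0.
Proof.
move=> d0; have k := omegahat_kernel hK; have k2 := K2 hK d0.
rewrite !b_delta_integral// -[RHS]mulN1r -RintegralZl//; last first.
  exact: b_delta_integrable.
by apply: eq_Rintegral => s _; rewrite phaseN sinN; ring.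
Qed.

Lemma lambda_deltaN delta (xi : freq) :
  lambda_delta w delta (- xi) = lambda_delta w delta xi.
Proof. by apply: eq_Rintegral => s _; rewrite phaseN cosN. Qed.

(** Apply [drift_lower] with [y = m / |xi|], where m is small enough for all
    delta up to delta0, and conclude with the Cauchy-Schwarz inequality
    [xi . b <= |xi| |b|]. *)
Lemma b_delta_sqrt_lower delta0 : 0 < delta0 ->
  exists2 c, 0 < c & forall delta (xi : freq), 0 < delta <= delta0 -> xi != 0 ->
    c * fnorm R xi `^ beta <= Num.sqrt (b_delta_sq hw delta xi).
Proof.
move=> d00; have [b1 [eps [c [e0 c0 hc]]]] := K4 hK.
have /andP[bm bp] := b1.
have dR : 0 < d%:R :> R by rewrite ltr0n.
pose m := Num.min (Num.min eps 1) delta0^-1 / 2.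
have mm : 0 < Num.min (Num.min eps 1) delta0^-1.
  by rewrite !lt_min e0 ltr01 invr_gt0.
have m0 : 0 < m by rewrite divr_gt0.
have m2 : m < Num.min (Num.min eps 1) delta0^-1 by rewrite /m; lra.
move: m2; rewrite !lt_min => /andP[/andP[me m1] md].
pose kappa := c / (4 * (2 * d%:R) ^+ (d + 2)).
have kappa0 : 0 < kappa.
  by rewrite divr_gt0// mulr_gt0// exprn_gt0// mulr_gt0.
exists (kappa * m `^ (1 - beta) * (1 + beta)).
  by apply: mulr_gt0; [apply: mulr_gt0 => //; exact: powR_gt0|lra].
move=> delta xi /andP[d0 dd0] xi0.
have f1 : 1 <= fnorm R xi by exact: fnorm_ge1.
have f0 : 0 < fnorm R xi by rewrite (lt_le_trans ltr01).
pose y := m / fnorm R xi.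
have y0 : 0 < y by rewrite divr_gt0.
have ym : y <= m by rewrite ler_pdivrMr// ler_peMr// ltW.
have yx : y * delta * fnorm R xi <= 1.
  have -> : y * delta * fnorm R xi = m * delta by rewrite /y mulrAC divfK ?gt_eqF.
  have <- : delta0^-1 * delta0 = 1 by rewrite mulVf// gt_eqF.
  by apply: ler_pM => //; exact: ltW.
have := @drift_lower R d d_gt0 hw delta xi (omegahat_kernel hK) d0 (K2 hK d0) (@K3 _
  _ _ _ _ hK)
  eps c beta b1 c0 hc y y0 (le_lt_trans ym m1) (le_lt_trans ym me) yx.
rewrite -/kappa => h.
have cs : \sum_(i < d) (xi i 0)%:~R * b_delta hw delta xi i 0 <=
    fnorm R xi * Num.sqrt (b_delta_sq hw delta xi).
  have b0 : 0 <= b_delta_sq hw delta xi.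
    by apply: sumr_ge0 => i _; exact: sqr_ge0.
  apply: (le_trans (ler_norm _)).
  rewrite -(@ler_pXn2r _ 2)// ?nnegrE ?mulr_ge0 ?sqrtr_ge0//.
  rewrite real_normK ?num_real// exprMn fnorm_sqr sqr_sqrtr//.
  exact: cauchy_schwarz.
rewrite -(ler_pM2l f0); apply: (le_trans _ cs); apply: (le_trans _ h).
rewrite le_eqVlt; apply/orP; left; apply/eqP.
have -> : y `^ (1 - beta) = m `^ (1 - beta) * fnorm R xi `^ (-1 * (1 - beta)).
  by rewrite /y (@powRM _ m) ?invr_ge0 ?(ltW f0) ?(ltW m0)// powRrM powR_inv1 ?(ltW f0).
have -> : fnorm R xi `^ beta = fnorm R xi `^ (-1 * (1 - beta)) * fnorm R xi.
  rewrite -{3}(powRr1 (ltW f0)) -powRD ?(gt_eqF f0) ?implybT//.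
  by congr (_ `^ _); ring.
ring.
Qed.
End Assumptions.

(** * The Stokes system at one frequency *)

Section Symbol.
Context (R : realType) (d : nat).
Notation freq := 'cV[int]_d.
Notation C := R[i].

Local Notation rc := (real_complex R).

Lemma real_complexM (x y : R) : rc (x * y) = rc x * rc y. Proof. exact: rmorphM. Qed.

Lemma b_deltaC_sqr (hw : R -> R) delta (xi : freq) :
  (b_deltaC hw delta xi)^T *m b_deltaC hw delta xi
  = (rc (b_delta_sq hw delta xi))%:M.
Proof.
apply/matrixP => i j; rewrite !ord1 !mxE eqxx mulr1n rmorph_sum.
by apply: eq_bigr => k _; rewrite !mxE rmorphXn expr2.
Qed.

Variables (nu : R) (w hw : R -> R) (delta : R) (xi : freq).
Let lam := lambda_delta w delta xi.
Let nb := b_delta_sq hw delta xi.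
Let b := b_deltaC hw delta xi.
Hypothesis nl0 : nu * lam != 0.
Hypothesis nb0 : nb != 0.

Lemma iC_sqr : 'i%C * 'i%C = -1 :> C.
Proof. by rewrite -expr2 sqr_i. Qed.

(** Block product; the only facts used are [i^2 = -1] and [b^T b = |b|^2]. *)
Lemma stokes_symbol_mulV :
  stokes_symbol nu w hw delta xi *m stokes_symbol_inv nu w hw delta xi = 1%:M.
Proof.
have nlV : rc (nu * lam) * rc (nu * lam)^-1 = 1 by rewrite -real_complexM mulfV.
have nbV : rc nb * rc nb^-1 = 1 by rewrite -real_complexM mulfV.
rewrite /stokes_symbol /stokes_symbol_inv -/lam -/nb -/b mulmx_block.
rewrite !mul0mx !addr0 !mul_scalar_mx !mul_mx_scalar -!scalemxAl -!scalemxAr.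
rewrite [RHS]scalar_mx_block; congr block_mx.
- rewrite !scalerA nlV scale1r mulrA mulrN iC_sqr.
  by rewrite opprK mul1r subrK.
- rewrite !scalerA -scalerDl (real_complexM (- (nu * lam))) rmorphN /=.
  set p := rc (nu * lam); set q := rc nb^-1.
  by rewrite (_ : p * ('i%C * q) + - p * q * 'i%C = 0) ?scale0r//; ring.
- rewrite mulmxBr mulmx1 -scalemxAr mulmxA b_deltaC_sqr mul_scalar_mx.
  by rewrite scalerA -/nb (mulrC (rc nb^-1)) nbV scale1r subrr !scaler0.
- rewrite b_deltaC_sqr -/nb !scalerA scale_scalar_mx; congr (_%:M).
  by rewrite mulrA mulNr iC_sqr opprK mul1r mulrC.
Qed.

Lemma stokes_symbol_unit : stokes_symbol nu w hw delta xi \in unitmx.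
Proof. by have [] := mulmx1_unit stokes_symbol_mulV. Qed.

Lemma stokes_symbol_invE :
  invmx (stokes_symbol nu w hw delta xi) = stokes_symbol_inv nu w hw delta xi.
Proof.
by rewrite -[LHS]mulmx1 -stokes_symbol_mulV mulmxA mulVmx ?mul1mx// stokes_symbol_unit.
Qed.

Lemma stokes_symbolP (f u : 'cV[C]_d) (p : 'cV[C]_1) :
  (- (rc nu *: - (rc lam *: u)) + 'i%C *: (b *m p) = f /\
   - ('i%C *: (b^T *m u)) = 0) <->
  stokes_symbol nu w hw delta xi *m col_mx u p = col_mx f 0.
Proof.
rewrite /stokes_symbol -/lam -/b mul_block_col mul0mx addr0 mul_scalar_mx.
rewrite -!scalemxAl scaleNr scalerN opprK scalerA -real_complexM.
by split=> [[-> ->]//|/eq_col_mx[-> ->]].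
Qed.

Lemma stokes_symbol_solve (f u : 'cV[C]_d) (p : 'cV[C]_1) :
  stokes_symbol nu w hw delta xi *m col_mx u p = col_mx f 0 <->
  col_mx u p = stokes_symbol_inv nu w hw delta xi *m col_mx f 0.
Proof.
split=> [<-|->]; last by rewrite mulmxA stokes_symbol_mulV mul1mx.
by rewrite -stokes_symbol_invE mulmxA mulVmx ?mul1mx// stokes_symbol_unit.
Qed.

(** The projection of f on the orthogonal of b, divided by nu lambda. *)
Definition velocity (f : 'cV[C]_d) : 'cV[C]_d :=
  rc (nu * lam)^-1 *: (f - rc nb^-1 *: (b *m (b^T *m f))).

Definition pressure (f : 'cV[C]_d) : 'cV[C]_1 :=
  (- 'i%C * rc nb^-1) *: (b^T *m f).

Lemma stokes_symbol_inv_col f :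
  stokes_symbol_inv nu w hw delta xi *m col_mx f 0 =
  col_mx (velocity f) (pressure f).
Proof.
rewrite /stokes_symbol_inv -/lam -/b -/nb mul_block_col !mulmx0 !addr0.
by rewrite -!scalemxAl mulmxBl mul1mx -scalemxAl -mulmxA.
Qed.

Lemma stokes_mode (f u : 'cV[C]_d) (p : 'cV[C]_1) :
  (- (rc nu *: - (rc lam *: u)) + 'i%C *: (b *m p) = f /\
   - ('i%C *: (b^T *m u)) = 0) <-> u = velocity f /\ p = pressure f.
Proof.
rewrite stokes_symbolP stokes_symbol_solve stokes_symbol_inv_col.
by split=> [/eq_col_mx|[-> ->]].
Qed.

Definition sqnorm k (v : 'cV[C]_k) : R := \sum_(j < k) Normc.normc (v j 0) ^+ 2.

Lemma sqnorm_ge0 k (v : 'cV[C]_k) : 0 <= sqnorm v.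
Proof. by apply: sumr_ge0 => j _; exact: sqr_ge0. Qed.

Lemma sqnorm0 k : sqnorm (0 : 'cV[C]_k) = 0.
Proof. by apply: big1 => j _; rewrite mxE Normc.normc0 expr0n. Qed.

Lemma normc_sqr (z : C) : Normc.normc z ^+ 2 = complex.Re z ^+ 2 + complex.Im z ^+ 2.
Proof. by case: z => x y /=; rewrite sqr_sqrtr// addr_ge0 ?sqr_ge0. Qed.

Lemma normc_real (x : R) : Normc.normc (rc x) = `|x|.
Proof. by rewrite /= expr0n addr0 sqrtr_sqr. Qed.

Lemma sqnormE k (v : 'cV[C]_k) :
  sqnorm v = \sum_(j < k) complex.Re (v j 0) ^+ 2 + \sum_(j < k) complex.Im (v j 0) ^+ 2.
Proof. by rewrite -big_split; apply: eq_bigr => j _; exact: normc_sqr. Qed.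

Lemma sqnormZ k (a : C) (v : 'cV[C]_k) :
  sqnorm (a *: v) = Normc.normc a ^+ 2 * sqnorm v.
Proof.
by rewrite mulr_sumr; apply: eq_bigr => j _; rewrite mxE Normc.normcM exprMn.
Qed.

Let re (v : 'cV[C]_d) j := complex.Re (v j 0).
Let im (v : 'cV[C]_d) j := complex.Im (v j 0).
Let br (j : 'I_d) := b_delta hw delta xi j 0.

Lemma b_deltaCE j : b j 0 = rc (br j).
Proof. by rewrite /b /b_deltaC /br [LHS]mxE. Qed.

Lemma dot_re_im (f : 'cV[C]_d) :
  (b^T *m f) 0 0 = ((\sum_j br j * re f j) +i* (\sum_j br j * im f j))%C.
Proof.
rewrite mxE; apply/eqP; rewrite eq_complex !raddf_sum/=.
apply/andP; split; apply/eqP; apply: eq_bigr => j _; rewrite [_^T _ _]mxE b_deltaCE;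
  by rewrite /re /im; case: (f j 0) => x y /=; rewrite mul0r ?subr0 ?addr0.
Qed.

(** The left-hand side is [|x|^2 - (b . x)^2 / |b|^2]. *)
Lemma proj_sqr_le (x : 'I_d -> R) :
  \sum_j (x j - nb^-1 * (br j * \sum_k br k * x k)) ^+ 2 <= \sum_j x j ^+ 2.
Proof.
pose z := \sum_k br k * x k; rewrite -/z.
rewrite (eq_bigr (fun j => x j ^+ 2 - 2 * nb^-1 * z * (br j * x j)
   + nb^-1 ^+ 2 * z ^+ 2 * br j ^+ 2)); last by move=> j _; ring.
rewrite big_split/= sumrB -!mulr_sumr -/z.
have -> : \sum_(j < d) br j ^+ 2 = nb by [].
have n0 : 0 <= nb^-1 by rewrite invr_ge0; apply: sumr_ge0 => j _; exact: sqr_ge0.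
have -> : nb^-1 ^+ 2 * z ^+ 2 * nb = nb^-1 * z ^+ 2 by field.
have := mulr_ge0 n0 (sqr_ge0 z); lra.
Qed.

Lemma velocity_coord (f : 'cV[C]_d) j :
  (f - rc nb^-1 *: (b *m (b^T *m f))) j 0 =
  ((re f j - nb^-1 * (br j * \sum_k br k * re f k)) +i*
   (im f j - nb^-1 * (br j * \sum_k br k * im f k)))%C.
Proof.
rewrite mxE [X in _ + X]mxE [X in - X]mxE [(b *m _) j 0]mxE big_ord1.
rewrite dot_re_im b_deltaCE; set sr := \sum_k br k * re f k.
set si := \sum_k br k * im f k; rewrite /re /im; case: (f j 0) => x y.
by apply/eqP; rewrite eq_complex /=; apply/andP; split; apply/eqP; ring.
Qed.

(** As b is real, the projection acts separately on the real and imaginary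
    parts of f. *)
Lemma velocity_sqnorm f : sqnorm (velocity f) <= (nu * lam)^-1 ^+ 2 * sqnorm f.
Proof.
rewrite sqnormZ normc_real real_normK ?num_real//.
apply: ler_wpM2l; first exact: sqr_ge0.
rewrite !sqnormE; apply: lerD.
  apply: le_trans (proj_sqr_le (re f)); apply: ler_sum => j _.
  by rewrite velocity_coord.
apply: le_trans (proj_sqr_le (im f)); apply: ler_sum => j _.
by rewrite velocity_coord.
Qed.

Lemma pressure_sqnorm f : sqnorm (pressure f) <= nb^-1 * sqnorm f.
Proof.
have n0 : 0 <= nb by apply: sumr_ge0 => j _; exact: sqr_ge0.
rewrite sqnormZ Normc.normcM normc_real.
have -> : Normc.normc (- 'i%C : C) = 1.
  by rewrite /= oppr0 expr0n sqrrN expr1n add0r sqrtr1.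
rewrite mul1r real_normK ?num_real// expr2 -mulrA; apply: ler_wpM2l;
  first by rewrite invr_ge0.
rewrite ler_pdivrMl; last by rewrite lt_def nb0.
rewrite /sqnorm big_ord1 dot_re_im normc_sqr/= -/(sqnorm f) sqnormE mulrDr.
by apply: lerD; exact: cauchy_schwarz.
Qed.

End Symbol.

(** * Solutions, norms and growth *)

Section Coefficients.
Context (R : realType) (d : nat).
Notation freq := 'cV[int]_d.

(** Both estimates of the theorem are comparisons of this kind, frequency by
    frequency. *)
Lemma weighted_norm_le k l (wt1 wt2 : freq -> R) (g : coeffs R d k)
    (h : coeffs R d l) (C : R) : 0 <= C ->
  (forall xi, xi != 0 -> 0 <= wt2 xi) ->
  (forall xi, xi != 0 ->
     wt1 xi * sqnorm (g xi) <= C ^+ 2 * (wt2 xi * sqnorm (h xi))) ->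
  (weighted_norm wt1 g <= C%:E * weighted_norm wt2 h)%E.
Proof.
move=> C0 w20 gh; rewrite /weighted_norm.
set P := (((2 * pi) ^- d)%:E)%E.
have P0 : (0 <= P)%E by rewrite lee_fin invr_ge0 exprn_ge0// mulr_ge0// pi_ge0.
set e1 := esum _ _; set e2 := esum _ _.
have b0 xi : xi != 0 -> 0 <= wt2 xi * sqnorm (h xi).
  by move=> x0; rewrite mulr_ge0 ?w20// sqnorm_ge0.
have e20 : (0 <= e2)%E by apply: esum_ge0 => xi /= x0; rewrite lee_fin b0.
have -> : (C%:E * sqrte (P * e2) = sqrte ((C ^+ 2)%:E * (P * e2)))%E.
  rewrite [RHS]sqrteM ?lee_fin ?sqr_ge0//; congr (_ * _)%E.
  by rewrite /= sqrtr_sqr ger0_norm.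
rewrite lee_sqrt; last by rewrite !mule_ge0// lee_fin sqr_ge0.
rewrite muleCA; apply: lee_wpmul2l => //.
apply: ge_ereal_sup => _ /= [X [finX XA] <-].
apply: (@le_trans _ _ ((C ^+ 2)%:E * \sum_(xi \in X)
    (wt2 xi * sqnorm (h xi))%:E)%E).
  rewrite !fsbig_finite//= big_seq [in leRHS]big_seq ge0_sume_distrr.
    apply: lee_sum => xi; rewrite in_fset_set// inE => /XA /= x0.
    by rewrite -EFinM lee_fin; exact: gh.
  by move=> xi; rewrite in_fset_set// inE lee_fin => /XA; exact: b0.
apply: lee_wpmul2l; first by rewrite lee_fin sqr_ge0.
by apply: ereal_sup_ubound; exists X.
Qed.

(** This is how the polynomial bounds on the inverse symbols make the solution
    a periodic distribution. *)
Lemma growth_transfer k l (f : coeffs R d k) (g : coeffs R d l) (A : R) (m : nat) :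
  0 <= A ->
  (exists (M : R) (N : nat), forall xi j,
    Normc.normc (f xi j 0) <= M * (1 + fnorm R xi) ^+ N) ->
  (forall xi, sqnorm (g xi) <= (A * (1 + fnorm R xi) ^+ m) ^+ 2 * sqnorm (f xi)) ->
  exists (M : R) (N : nat), forall xi j,
    Normc.normc (g xi j 0) <= M * (1 + fnorm R xi) ^+ N.
Proof.
move=> A0 [M [N fM]] gf; exists (A * (k.+1%:R * `|M|)), (m + N)%N => xi j.
have F0 n : 0 <= (1 + fnorm R xi) ^+ n by rewrite exprn_ge0// addr_ge0// fnorm_ge0.
rewrite -(@ler_pXn2r _ 2)// ?nnegrE ?mulr_ge0 ?normr_ge0 ?sqrtr_ge0//; last first.
  by case: (g xi j 0) => x y; exact: sqrtr_ge0.
apply: (@le_trans _ _ (sqnorm (g xi))).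
  by rewrite /sqnorm (bigD1 j)//= lerDl sumr_ge0// => i _; exact: sqr_ge0.
apply: (le_trans (gf xi)).
have -> : A * (k.+1%:R * `|M|) * (1 + fnorm R xi) ^+ (m + N) =
    (A * (1 + fnorm R xi) ^+ m) * (k.+1%:R * (`|M| * (1 + fnorm R xi) ^+ N)).
  by rewrite exprD; ring.
rewrite [leRHS]exprMn; apply: ler_wpM2l; first exact: sqr_ge0.
set B := `|M| * _.
have B0 : 0 <= B by rewrite mulr_ge0.
apply: (@le_trans _ _ (\sum_(i < k) B ^+ 2)).
  apply: ler_sum => i _; apply: lerXn2r; rewrite ?nnegrE//.
    by case: (f xi i 0) => x y; exact: sqrtr_ge0.
  apply: (le_trans (fM xi i)); apply: ler_wpM2r => //; exact: ler_norm.
rewrite sumr_const card_ord -[leLHS]mulr_natl [leRHS]exprMn; apply: ler_wpM2r;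
  first exact: sqr_ge0.
by rewrite -natrX ler_nat (leq_trans (leqnSn k))// -{1}(expn1 k.+1) leq_pexp2l.
Qed.

End Coefficients.

Section Solution.
Context (R : realType) (d : nat) (nu : R) (w hw : R -> R) (beta : R).
Notation freq := 'cV[int]_d.
Hypothesis d_gt0 : (0 < d)%N.
Hypothesis hnu : 0 < nu.
Hypothesis hK : kernel_assumptions d w hw beta.

Lemma lambda_gt0 delta (xi : freq) : 0 < delta -> xi != 0 ->
  0 < lambda_delta w delta xi.
Proof.
move=> d0 x0; have [c c0 cl] := lambda_lower_bound d_gt0 (omega_kernel hK) (K1 hK) d0.
exact: lt_le_trans (cl xi x0).
Qed.

Lemma b_delta_sq_lower delta0 : 0 < delta0 -> exists2 c, 0 < c &
  forall delta (xi : freq), 0 < delta <= delta0 -> xi != 0 ->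
  c ^+ 2 * fnorm R xi `^ (2 * beta) <= b_delta_sq hw delta xi.
Proof.
move=> /(b_delta_sqrt_lower d_gt0 hK)[c c0 cl]; exists c => // delta xi dd x0.
have b0 : 0 <= b_delta_sq hw delta xi by apply: sumr_ge0 => i _; exact: sqr_ge0.
rewrite -[leRHS]sqr_sqrtr//.
have -> : fnorm R xi `^ (2 * beta) = (fnorm R xi `^ beta) ^+ 2.
  by rewrite -powR_mulrn ?powR_ge0// -powRrM mulrC.
rewrite -exprMn; apply: lerXn2r; rewrite ?nnegrE ?sqrtr_ge0//.
  by rewrite mulr_ge0 ?powR_ge0// ltW.
exact: cl.
Qed.

Lemma b_delta_sq_gt0 delta (xi : freq) : 0 < delta -> xi != 0 ->
  0 < b_delta_sq hw delta xi.
Proof.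
move=> d0 x0; have [c c0 cl] := b_delta_sq_lower d0.
apply: lt_le_trans (cl delta xi _ x0); last by rewrite d0 lexx.
rewrite mulr_gt0 ?exprn_gt0// powR_gt0//.
exact: lt_le_trans (fnorm_ge1 R x0).
Qed.

Lemma stokes_solution_mode delta (f u : coeffs R d d) (p : coeffs R d 1) (xi : freq) :
  0 < delta -> stokes_solution nu w hw delta f u p -> xi != 0 ->
  u xi = velocity nu w hw delta xi (f xi) /\ p xi = pressure hw delta xi (f xi).
Proof.
move=> d0 [_ _ e1 e2] x0; apply/stokes_mode.
- by rewrite mulf_neq0// gt_eqF// lambda_gt0.
- by rewrite gt_eqF// b_delta_sq_gt0.
- by split; [exact: e1|exact: e2].
Qed.

(** For the velocity the inverse symbol is bounded, since lambda is bounded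
    below; for the pressure it grows at most linearly, since
    [|b| >= c |xi|^beta >= c / |xi|]. *)
Lemma stokes_existence delta (f : coeffs R d d) : 0 < delta -> mean_zero_periodic f ->
  stokes_solution nu w hw delta f
    (fun xi => if xi == 0 then 0 else velocity nu w hw delta xi (f xi))
    (fun xi => if xi == 0 then 0 else pressure hw delta xi (f xi)).
Proof.
move=> d0 [f0 fgrow].
have [cl cl0 hl] := lambda_lower_bound d_gt0 (omega_kernel hK) (K1 hK) d0.
have [cb cb0 hb] := b_delta_sq_lower d0.
have bm : -1 < beta by have [/andP[]] := K4 hK.
have F1 (xi : freq) : xi != 0 -> 1 <= fnorm R xi by exact: fnorm_ge1.
have F0 (xi : freq) : 0 <= fnorm R xi by exact: fnorm_ge0.
have mode xi x0 := @stokes_mode R d nu w hw delta xi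
  (lt0r_neq0 (mulr_gt0 hnu (lambda_gt0 d0 x0))) (lt0r_neq0 (b_delta_sq_gt0 d0 x0))
  (f xi) (velocity nu w hw delta xi (f xi)) (pressure hw delta xi (f xi)).
split.
- split; first by rewrite eqxx.
  apply: (@growth_transfer _ _ _ _ f _ (nu * cl)^-1 0) => //.
    by rewrite invr_ge0 ltW// mulr_gt0.
  move=> xi; case: (eqVneq xi 0) => [->|x0].
    by rewrite sqnorm0 mulr_ge0 ?sqr_ge0 ?sqnorm_ge0.
  rewrite expr0 mulr1; apply: (le_trans (velocity_sqnorm _ _ _ _)).
    by rewrite gt_eqF// b_delta_sq_gt0.
  apply: ler_wpM2r; first exact: sqnorm_ge0.
  have l0 : 0 < lambda_delta w delta xi by exact: lambda_gt0.
  apply: lerXn2r; rewrite ?nnegrE ?invr_ge0 ?mulr_ge0 ?(ltW hnu) ?(ltW l0) ?(ltW cl0)//.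
  by rewrite lef_pV2 ?posrE ?mulr_gt0// ler_pM2l// hl.
- split; first by rewrite eqxx.
  apply: (@growth_transfer _ _ _ _ f _ cb^-1 1) => //.
    by rewrite invr_ge0 ltW.
  move=> xi; case: (eqVneq xi 0) => [->|x0].
    by rewrite sqnorm0 mulr_ge0 ?sqr_ge0 ?sqnorm_ge0.
  apply: (le_trans (pressure_sqnorm _ _)).
    by rewrite gt_eqF// b_delta_sq_gt0.
  apply: ler_wpM2r; first exact: sqnorm_ge0.
  have b0 := b_delta_sq_gt0 d0 x0.
  have f1 := F1 _ x0.
  have fp : 0 < fnorm R xi by rewrite (lt_le_trans ltr01).
  rewrite expr1 -[leRHS]invrK lef_pV2 ?posrE// ?invr_gt0 ?exprn_gt0 ?mulr_gt0
    ?invr_gt0//; last by rewrite addr_gt0.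
  apply: le_trans (hb delta xi _ x0); last by rewrite d0 lexx.
  rewrite -exprVn invfM invrK exprMn; apply: ler_wpM2l; first exact: sqr_ge0.
  apply: (@le_trans _ _ (fnorm R xi `^ (- 2%:R))).
    rewrite powR_invn// exprVn lef_pV2 ?posrE ?exprn_gt0 ?addr_gt0//.
    by apply: lerXn2r; rewrite ?nnegrE ?addr_ge0// lerDr.
  by apply: ler_powR => //; lra.
- move=> xi; rewrite /nonlocal_laplacian /nonlocal_gradient.
  case: (eqVneq xi 0) => [->|x0].
    by rewrite f0 mulmx0 !scaler0 oppr0 scaler0 oppr0 addr0.
  by have [_ /(_ (conj erefl erefl))[]] := mode xi x0.
- move=> xi; rewrite /nonlocal_divergence.
  case: (eqVneq xi 0) => [->|x0]; first by rewrite mulmx0 scaler0 oppr0.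
  by have [_ /(_ (conj erefl erefl))[]] := mode xi x0.
Qed.

Lemma b_deltaCN delta (xi : freq) : 0 < delta ->
  b_deltaC hw delta (- xi) = - b_deltaC hw delta xi.
Proof.
move=> d0; apply/matrixP => i j; rewrite (ord1 j).
rewrite [LHS]mxE (b_deltaN d_gt0 hK xi i d0) [RHS]mxE [X in _ = - X]mxE.
exact: rmorphN.
Qed.

Lemma b_delta_sqN delta (xi : freq) : 0 < delta ->
  b_delta_sq hw delta (- xi) = b_delta_sq hw delta xi.
Proof.
move=> d0; apply: eq_bigr => i _.
by rewrite (b_deltaN d_gt0 hK xi i d0) sqrrN.
Qed.

Lemma conj_b_deltaC delta (xi : freq) :
  map_mx (@conjc R) (b_deltaC hw delta xi) = b_deltaC hw delta xi.
Proof.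
apply/matrixP => i j; rewrite [LHS]mxE.
have -> : b_deltaC hw delta xi i j = real_complex R (b_delta hw delta xi i j).
  by rewrite [LHS]mxE.
exact: conjc_real.
Qed.

Lemma map_conjc_scale m n (a : R[i]) (v : 'M[R[i]]_(m, n)) :
  map_mx (@conjc R) (a *: v) = (conjc a) *: map_mx (@conjc R) v.
Proof. by apply/matrixP => i j; rewrite !mxE; exact: rmorphM. Qed.

(** The symbol lambda is even and b is odd, and b occurs twice. *)
Lemma velocity_conj delta (xi : freq) f : 0 < delta ->
  velocity nu w hw delta (- xi) (map_mx (@conjc R) f) =
  map_mx (@conjc R) (velocity nu w hw delta xi f).
Proof.
move=> d0; rewrite /velocity lambda_deltaN b_delta_sqN// b_deltaCN//.
rewrite map_conjc_scale map_mxB map_conjc_scale !map_mxM -map_trmx conj_b_deltaC !conjc_real.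
by rewrite raddfN /= !mulNmx mulmxN opprK.
Qed.

(** The sign coming from the oddness of b compensates the one coming from the
    conjugation of the factor - i. *)
Lemma pressure_conj delta (xi : freq) f : 0 < delta ->
  pressure hw delta (- xi) (map_mx (@conjc R) f) =
  map_mx (@conjc R) (pressure hw delta xi f).
Proof.
move=> d0; rewrite /pressure b_delta_sqN// b_deltaCN//.
rewrite map_conjc_scale map_mxM -map_trmx conj_b_deltaC.
rewrite raddfN /= mulNmx scalerN -scaleNr; congr (_ *: _).
by apply/eqP; rewrite eq_complex /=; apply/andP; split; apply/eqP; ring.
Qed.

End Solution.

(** * Well-posedness *)

Theorem theorem7 (R : realType) (d : nat) (nu : R) (w hw : R -> R) (beta : R)
    (hd : d = 2%N \/ d = 3%N) (hnu : 0 < nu)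
    (hK : kernel_assumptions d w hw beta) :
  (forall (delta : R) (f : coeffs R d d),
     0 < delta -> mean_zero_periodic f ->
     exists (u : coeffs R d d) (p : coeffs R d 1),
       [/\ stokes_solution nu w hw delta f u p,
           (forall (u' : coeffs R d d) (p' : coeffs R d 1),
              stokes_solution nu w hw delta f u' p' -> u' = u /\ p' = p),
           (forall xi : 'cV[int]_d, xi != 0 ->
              [/\ stokes_symbol nu w hw delta xi \in unitmx,
                  invmx (stokes_symbol nu w hw delta xi)
                    = stokes_symbol_inv nu w hw delta xi &
                  col_mx (u xi) (p xi)
                    = invmx (stokes_symbol nu w hw delta xi)
                        *m col_mx (f xi) 0]) &
           (real_valued f -> real_valued u /\ real_valued p)])
  /\
  (exists C : R, 0 < C /\
     forall (delta : R) (f u : coeffs R d d) (p : coeffs R d 1),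
       0 < delta -> mean_zero_periodic f ->
       stokes_solution nu w hw delta f u p ->
       (energy_norm w delta u <= C%:E * dual_energy_norm w delta f)%E)
  /\
  (forall delta0 : R, 0 < delta0 ->
     exists C : R, 0 < C /\
     forall (delta : R) (f u : coeffs R d d) (p : coeffs R d 1),
       0 < delta <= delta0 -> mean_zero_periodic f ->
       stokes_solution nu w hw delta f u p ->
       (L2_norm p <= C%:E * Hs_norm (- beta) f)%E).
Proof.
have d_gt0 : (0 < d)%N by case: hd => ->.
split; [|split].
- move=> delta f d0 mf; exists
    (fun xi => if xi == 0 then 0 else velocity nu w hw delta xi (f xi)),
    (fun xi => if xi == 0 then 0 else pressure hw delta xi (f xi)).
  have nl0 (xi : 'cV[int]_d) : xi != 0 -> nu * lambda_delta w delta xi != 0.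
    move=> x0; apply: lt0r_neq0; apply: mulr_gt0 => //; exact: (lambda_gt0 d_gt0 hK).
  have nb0 (xi : 'cV[int]_d) : xi != 0 -> b_delta_sq hw delta xi != 0.
    by move=> x0; rewrite gt_eqF// (b_delta_sq_gt0 d_gt0 hK).
  split.
  + exact: (stokes_existence d_gt0 hnu hK).
  + move=> u' p' sol; have [[u0 _] [p0 _] _ _] := sol.
    split; apply/funext => xi; case: eqVneq => [->//|x0].
      by have [] := stokes_solution_mode d_gt0 hnu hK d0 sol x0.
    by have [] := stokes_solution_mode d_gt0 hnu hK d0 sol x0.
  + move=> xi x0; rewrite (negbTE x0); split.
    * exact: stokes_symbol_unit (nl0 _ x0) (nb0 _ x0).
    * exact: stokes_symbol_invE (nl0 _ x0) (nb0 _ x0).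
    * by rewrite stokes_symbol_invE ?nl0 ?nb0// stokes_symbol_inv_col.
  + move=> fr; split=> xi; rewrite oppr_eq0; case: eqVneq => x0.
    * by rewrite map_mx0.
    * by rewrite fr (velocity_conj nu d_gt0 hK).
    * by rewrite map_mx0.
    * by rewrite fr (pressure_conj d_gt0 hK).
- exists nu^-1; rewrite invr_gt0; split=> // delta f u p d0 mf sol.
  apply: weighted_norm_le; first by rewrite invr_ge0 ltW.
    by move=> xi x0; rewrite invr_ge0 ltW// (lambda_gt0 d_gt0 hK).
  move=> xi x0; have [-> _] := stokes_solution_mode d_gt0 hnu hK d0 sol x0.
  have l0 := lambda_gt0 d_gt0 hK d0 x0.
  have nb0 : b_delta_sq hw delta xi != 0 by rewrite gt_eqF// (b_delta_sq_gt0 d_gt0 hK).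
  have := velocity_sqnorm nu w nb0 (f xi).
  move=> /(ler_wpM2l (ltW l0)) /le_trans; apply.
  rewrite le_eqVlt; apply/orP; left; apply/eqP.
  by field; rewrite !gt_eqF.
- move=> delta0 d00; have [c c0 cl] := b_delta_sq_lower d_gt0 hK d00.
  exists c^-1; rewrite invr_gt0; split=> // delta f u p /andP[d0 dd] mf sol.
  apply: weighted_norm_le; first by rewrite invr_ge0 ltW.
    by move=> xi x0; exact: powR_ge0.
  move=> xi x0; have [_ ->] := stokes_solution_mode d_gt0 hnu hK d0 sol x0.
  have b0 := b_delta_sq_gt0 d_gt0 hK d0 x0.
  rewrite mulr0 powRr0 mul1r mulrA.
  apply: (le_trans (pressure_sqnorm (lt0r_neq0 b0) _)).
  apply: ler_wpM2r; first exact: sqnorm_ge0.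
  have fp : 0 < fnorm R xi by exact: lt_le_trans (fnorm_ge1 R x0).
  rewrite mulrN powRN exprVn -invfM lef_pV2 ?posrE//; last first.
    by rewrite mulr_gt0 ?exprn_gt0 ?powR_gt0.
  by apply: cl => //; rewrite d0.
Qed.
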